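(* Let $\rho:X\to\mathbb{A}^2_*$ and $\rho':X'\to\mathbb{A}^2_*$ be nontrivial homogeneous $\mathbb{G}_a$-bundles of homogeneous degrees $-d$ and $-d'$ respectively ($d,d'\geq 2$), with $X$ and $X'$ equipped with their lifts of the $\mathbb{G}_m$-action $\sigma$ on $\mathbb{A}^2_*$ (as described in the context). Then the total spaces $X$ and $X'$ are $\mathbb{G}_m$-equivariantly isomorphic (as algebraic varieties with $\mathbb{G}_m$-action) if and only if $d=d'$. In particular, for a fixed $d\geq 2$, the total spaces of nontrivial $-d$-homogeneous $\mathbb{G}_a$-bundles $\rho:X\to\mathbb{A}^2_*$ are all isomorphic as abstract affine varieties.
   Context: Everything is over $\mathbb{C}$. $\mathbb{A}^2_*=\mathrm{Spec}(\mathbb{C}[x,y])\setminus\{(0,0)\}$. A $\mathbb{G}_a$-bundle over $\mathbb{A}^2_*$ is a Zariski locally trivial principal $\mathbb{G}_a$-bundle $\rho:X\to\mathbb{A}^2_*$; isomorphism classes of these are in bijection with $H^1(\mathbb{A}^2_*,\mathcal{O}_{\mathbb{A}^2_*})$, the trivial bundle corresponding to $0$. Let $\sigma:\mathbb{G}_m\times\mathbb{A}^2_*\to\mathbb{A}^2_*$, $\sigma(\lambda,(x,y))=(\lambda x,\lambda y)$, with quotient morphism $\pi:\mathbb{A}^2_*\to\mathbb{P}^1$. Since $\pi$ is affine and $\pi_*\mathcal{O}_{\mathbb{A}^2_*}\simeq\bigoplus_{d\in\mathbb{Z}}\mathcal{O}_{\mathbb{P}^1}(-d)$, one has $H^1(\mathbb{A}^2_*,\mathcal{O}_{\mathbb{A}^2_*})\simeq\bigoplus_{d\geq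 2}H^1(\mathbb{P}^1,\mathcal{O}_{\mathbb{P}^1}(-d))$. A nontrivial $\mathbb{G}_a$-bundle $\rho:X\to\mathbb{A}^2_*$ is called $-d$-homogeneous (homogeneous of degree $-d$), $d\geq 2$, if its class lies in the summand $H^1(\mathbb{P}^1,\mathcal{O}_{\mathbb{P}^1}(-d))$. Equivalently, up to isomorphism of $\mathbb{G}_a$-bundles, there is a lift $\tilde\sigma:\mathbb{G}_m\times X\to X$ of $\sigma$ (a $\mathbb{G}_m$-action on $X$ making $\rho$ equivariant) and $\mathbb{G}_a$-equivariant local trivializations $\tau_i:X|_{U_i}\xrightarrow{\sim}U_i\times\mathbb{G}_a$ over a covering $(U_i)_{i\in I}$ of $\mathbb{A}^2_*$ by $\mathbb{G}_m$-stable affine open subsets such that each $\tau_i$ is $\mathbb{G}_m$-equivariant for the action $\lambda\cdot(u,t)=(\sigma(\lambda,u),\lambda^{-d}t)$ on $U_i\times\mathbb{G}_a$. Every $-d$-homogeneous $\mathbb{G}_a$-bundle is considered as equipped with such a lift $\tilde\sigma$, and $\mathbb{G}_m$-equivariance of isomorphisms between total spaces refers to these actions. *)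

(* Defs.v *)
From HB Require Import structures.
From mathcomp Require Import all_boot all_order all_algebra.
From mathcomp Require Import boolp classical_sets reals.
From mathcomp Require Import mpoly.
From mathcomp.real_closed Require Export complex.

Set Implicit Arguments.
Unset Strict Implicit.
Unset Printing Implicit Defensive.

Import GRing.Theory.
Local Open Scope classical_set_scope.
Local Open Scope ring_scope.

(* Varieties over an algebraically closed field [K] are treated in the style
   of Serre's FAC: sets with a topology and a sheaf of [K]-algebras of
   [K]-valued functions, glued from finitely many closed subsets of affine
   spaces.  The Zariski topology is a field of the record, rather than a
   [topologicalType] instance, because for [K] the complex numbers the library
   already equips ['rV[K]_n] and products with other topologies.

   [regular_on U f] says that the restriction of [f] to [U] is a section of the
   structure sheaf over the open set [U]; the values of [f] outside [U] are
   irrelevant. *)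
Record space (K : closedFieldType) := Space {
  pt :> Type;
  zopen : set (set pt);
  regular_on : set pt -> set (pt -> K);
  zopenT : zopen setT;
  zopenI : forall U V, zopen U -> zopen V -> zopen (U `&` V);
  zopen_bigcup : forall (I : Type) (U : I -> set pt),
    (forall i, zopen (U i)) -> zopen (\bigcup_i U i);
  regular_ext : forall U f g, zopen U -> (forall x, U x -> f x = g x) ->
    regular_on U f -> regular_on U g;
  regular_sub : forall U V f, zopen U -> zopen V -> V `<=` U ->
    regular_on U f -> regular_on V f;
  regular_glue : forall U f, zopen U ->
    (forall x, U x -> exists V, [/\ zopen V, V x, V `<=` U & regular_on V f]) ->
    regular_on U f;
  regular_cst : forall U (a : K), zopen U -> regular_on U (fun=> a);
  regularD : forall U f g, zopen U -> regular_on U f -> regular_on U g ->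
    regular_on U (fun x => f x + g x);
  regularM : forall U f g, zopen U -> regular_on U f -> regular_on U g ->
    regular_on U (fun x => f x * g x)
}.

Definition regular_map (K : closedFieldType) (X Y : space K) (f : X -> Y) : Prop :=
  forall V, zopen V ->
    zopen (f @^-1` V) /\
    forall g, regular_on V g -> regular_on (f @^-1` V) (g \o f).

Definition is_iso (K : closedFieldType) (X Y : space K) (f : X -> Y) : Prop :=
  regular_map f /\
  exists g : Y -> X, [/\ regular_map g, cancel f g & cancel g f].

Definition isomorphic (K : closedFieldType) (X Y : space K) : Prop :=
  exists f : X -> Y, is_iso f.

Section AffineSpace.
Variables (K : closedFieldType) (n : nat).
Implicit Types (x : 'rV[K]_n) (p q : {mpoly K[n]}).

Definition peval p x : K := p.@[fun i => x 0 i].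

Definition affine_open (U : set 'rV[K]_n) : Prop :=
  exists S : set {mpoly K[n]}, U = [set x | exists2 p, S p & peval p x != 0].

Definition affine_regular (U : set 'rV[K]_n) (f : 'rV[K]_n -> K) : Prop :=
  forall x, U x -> exists p q, peval q x != 0 /\
    forall y, U y -> peval q y != 0 -> f y = peval p y / peval q y.

Let pevalM p q x : peval (p * q) x = peval p x * peval q x.
Proof. exact: mevalM. Qed.

Let pevalD p q x : peval (p + q) x = peval p x + peval q x.
Proof. exact: mevalD. Qed.

Let pevalC (a : K) x : peval a%:MP x = a.
Proof. exact: mevalC. Qed.

Lemma affine_openT : affine_open setT.
Proof.
exists [set 1%:MP]; apply/seteqP; split=> x //= _.
by exists 1%:MP => //; rewrite pevalC oner_neq0.
Qed.

Lemma affine_openI U V : affine_open U -> affine_open V -> affine_open (U `&` V).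
Proof.
move=> [S ->] [T ->].
exists [set p * q | p in S & q in T]; apply/seteqP; split=> x /=.
  move=> [[p Sp px] [q Tq qx]]; exists (p * q); first by exists p => //; exists q.
  by rewrite pevalM mulf_neq0.
move=> [_ [p Sp [q Tq <-]]]; rewrite pevalM mulf_eq0 negb_or => /andP[px qx].
by split; [exists p | exists q].
Qed.

Lemma affine_open_bigcup (I : Type) (U : I -> set 'rV[K]_n) :
  (forall i, affine_open (U i)) -> affine_open (\bigcup_i U i).
Proof.
move=> /choice[S US].
exists (\bigcup_i S i); apply/seteqP; split=> x /=.
  by move=> [i _]; rewrite US => -[p Sp px]; exists p => //; exists i.
by move=> [p [i _ Sp] px]; exists i => //; rewrite US; exists p.
Qed.

Lemma affine_regular_ext U f g : affine_open U ->
  (forall x, U x -> f x = g x) -> affine_regular U f -> affine_regular U g.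
Proof.
move=> _ fg rf x Ux; have [p [q [qx fE]]] := rf x Ux.
by exists p, q; split=> // y Uy qy; rewrite -fg// fE.
Qed.

Lemma affine_regular_sub U V f : affine_open U -> affine_open V -> V `<=` U ->
  affine_regular U f -> affine_regular V f.
Proof.
move=> _ _ VU rf x Vx; have [p [q [qx fE]]] := rf x (VU _ Vx).
by exists p, q; split=> // y Vy; exact/fE/VU.
Qed.

Lemma affine_regular_glue U f : affine_open U ->
  (forall x, U x -> exists V,
     [/\ affine_open V, V x, V `<=` U & affine_regular V f]) ->
  affine_regular U f.
Proof.
move=> _ loc x Ux; have [_ [[S ->] Vx _ rf]] := loc x Ux.
have [p [q [qx fE]]] := rf x Vx; have [r Sr rx] := Vx.
exists (p * r), (q * r); rewrite pevalM mulf_neq0//; split=> // y Uy.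
rewrite !pevalM mulf_eq0 negb_or => /andP[qy ry].
by rewrite -mulf_div divff// mulr1; apply: fE => //; exists r.
Qed.

Lemma affine_regular_cst U (a : K) : affine_open U ->
  affine_regular U (fun=> a).
Proof.
move=> _ x _; exists a%:MP, 1%:MP; rewrite pevalC oner_neq0; split=> // y _ _.
by rewrite !pevalC divr1.
Qed.

Lemma affine_regularD U f g : affine_open U -> affine_regular U f ->
  affine_regular U g -> affine_regular U (fun x => f x + g x).
Proof.
move=> _ rf rg x Ux.
have [p [q [qx fE]]] := rf x Ux; have [r [s [sx gE]]] := rg x Ux.
exists (p * s + r * q), (q * s); rewrite pevalM mulf_neq0//; split=> // y Uy.
rewrite pevalM mulf_eq0 negb_or => /andP[qy sy].
by rewrite fE// gE// addf_div// pevalD !pevalM.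
Qed.

Lemma affine_regularM U f g : affine_open U -> affine_regular U f ->
  affine_regular U g -> affine_regular U (fun x => f x * g x).
Proof.
move=> _ rf rg x Ux.
have [p [q [qx fE]]] := rf x Ux; have [r [s [sx gE]]] := rg x Ux.
exists (p * r), (q * s); rewrite pevalM mulf_neq0//; split=> // y Uy.
rewrite pevalM mulf_eq0 negb_or => /andP[qy sy].
by rewrite fE// gE// mulf_div !pevalM.
Qed.

Definition affine_space : space K :=
  Space affine_openT affine_openI affine_open_bigcup affine_regular_ext
    affine_regular_sub affine_regular_glue affine_regular_cst affine_regularD
    affine_regularM.

End AffineSpace.
Arguments affine_space K n : clear implicits.

(* The induced structure on an arbitrary subset: regular functions are those
   that extend locally to the ambient space.  It is used for open subsets and
   for closed subsets alike (the latter with their reduced structure). *)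
Section Subspace.
Variables (K : closedFieldType) (X : space K) (A : set X).
Notation T := {x : X | A x}.

Definition sub_open (V : set T) : Prop :=
  exists2 W, zopen W & V = (@sval X A) @^-1` W.

Definition sub_regular (V : set T) (f : T -> K) : Prop :=
  forall x, V x -> exists W g, [/\ zopen W, W (sval x), regular_on W g &
    forall y, V y -> W (sval y) -> f y = g (sval y)].

Lemma sub_openT : sub_open setT.
Proof. by exists setT => //; exact: zopenT. Qed.

Lemma sub_openI U V : sub_open U -> sub_open V -> sub_open (U `&` V).
Proof. by move=> [U' oU ->] [V' oV ->]; exists (U' `&` V') => //; exact: zopenI. Qed.

Lemma sub_open_bigcup (I : Type) (U : I -> set T) :
  (forall i, sub_open (U i)) -> sub_open (\bigcup_i U i).
Proof.
move=> h; have /choice[W WE] : forall i, exists W, zopen W /\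
    U i = (@sval X A) @^-1` W by move=> i; have [W] := h i; exists W.
exists (\bigcup_i W i); first by apply: zopen_bigcup => i; case: (WE i).
by apply/seteqP; split=> x [i _ Uix]; exists i => //; move: Uix; case: (WE i) => _ ->.
Qed.

Lemma sub_regular_ext U f g : sub_open U ->
  (forall x, U x -> f x = g x) -> sub_regular U f -> sub_regular U g.
Proof.
move=> _ fg rf x Ux; have [W [h [oW Wx rh fE]]] := rf x Ux.
by exists W, h; split=> // y Uy Wy; rewrite -fg// fE.
Qed.

Lemma sub_regular_sub U V f : sub_open U -> sub_open V -> V `<=` U ->
  sub_regular U f -> sub_regular V f.
Proof.
move=> _ _ VU rf x Vx; have [W [h [oW Wx rh fE]]] := rf x (VU _ Vx).
by exists W, h; split=> // y Vy; exact/fE/VU.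
Qed.

Lemma sub_regular_glue U f : sub_open U ->
  (forall x, U x -> exists V,
     [/\ sub_open V, V x, V `<=` U & sub_regular V f]) ->
  sub_regular U f.
Proof.
move=> _ loc x Ux; have [V [[V' oV' VE] Vx VU rf]] := loc x Ux.
have [W [h [oW Wx rh fE]]] := rf x Vx.
exists (W `&` V'), h; split; [exact: zopenI|by move: Vx; rewrite VE| |].
  by apply: regular_sub rh => //; try exact: zopenI; move=> ? [].
by move=> y Uy [Wy V'y]; apply: fE => //; rewrite VE.
Qed.

Lemma sub_regular_cst U (a : K) : sub_open U -> sub_regular U (fun=> a).
Proof.
move=> _ x _; exists setT, (fun=> a); split=> //; first exact: zopenT.
exact/regular_cst/zopenT.
Qed.

Lemma sub_regularD U f g : sub_open U -> sub_regular U f ->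
  sub_regular U g -> sub_regular U (fun x => f x + g x).
Proof.
move=> _ rf rg x Ux; have [V [h [oV Vx rh fE]]] := rf x Ux.
have [W [k [oW Wx rk gE]]] := rg x Ux; have oVW := zopenI oV oW.
exists (V `&` W), (fun z => h z + k z); split=> //.
  by apply: regularD => //; [apply: regular_sub rh|apply: regular_sub rk] => // ? [].
by move=> y Uy [Vy Wy]; rewrite fE// gE.
Qed.

Lemma sub_regularM U f g : sub_open U -> sub_regular U f ->
  sub_regular U g -> sub_regular U (fun x => f x * g x).
Proof.
move=> _ rf rg x Ux; have [V [h [oV Vx rh fE]]] := rf x Ux.
have [W [k [oW Wx rk gE]]] := rg x Ux; have oVW := zopenI oV oW.
exists (V `&` W), (fun z => h z * k z); split=> //.
  by apply: regularM => //; [apply: regular_sub rh|apply: regular_sub rk] => // ? [].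
by move=> y Uy [Vy Wy]; rewrite fE// gE.
Qed.

Definition induced_space : space K :=
  Space sub_openT sub_openI sub_open_bigcup sub_regular_ext
    sub_regular_sub sub_regular_glue sub_regular_cst sub_regularD
    sub_regularM.

End Subspace.

(* The product of varieties.  Its topology is finer than the product topology:
   a basis is given by the loci in [U `*` V] where a function
   [\sum_i a_i(x) b_i(y)], with [a_i] regular on [U] and [b_i] on [V], does
   not vanish. *)
Section Product.
Variables (K : closedFieldType) (X Y : space K).

Definition tensor (U : set X) (V : set Y) (F : X * Y -> K) : Prop :=
  exists (I : finType) (a : I -> X -> K) (b : I -> Y -> K),
    [/\ forall i, regular_on U (a i), forall i, regular_on V (b i) &
        forall z, F z = \sum_i a i z.1 * b i z.2].

Definition prod_open (W : set (X * Y)) : Prop :=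
  forall z, W z -> exists U V F,
    [/\ zopen U /\ zopen V, U z.1 /\ V z.2, tensor U V F, F z != 0 &
        forall w, U w.1 -> V w.2 -> F w != 0 -> W w].

Definition prod_regular (W : set (X * Y)) (f : X * Y -> K) : Prop :=
  forall z, W z -> exists U V F G,
    [/\ zopen U /\ zopen V, U z.1 /\ V z.2, tensor U V F /\ tensor U V G,
        G z != 0 &
        forall w, W w -> U w.1 -> V w.2 -> G w != 0 -> f w = F w / G w].

Let tensor_cst U V (a : K) : zopen U -> zopen V -> tensor U V (fun=> a).
Proof.
move=> oU oV; exists unit, (fun=> fun=> a), (fun=> fun=> 1).
split=> [_|_|z]; [exact: regular_cst|exact: regular_cst|].
by rewrite big_const card_unit /= addr0 mulr1.
Qed.

Let tensorD U V F G : tensor U V F -> tensor U V G ->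
  tensor U V (fun z => F z + G z).
Proof.
move=> [I [a [b [ra rb FE]]]] [J [c [e [rc re GE]]]].
exists (I + J)%type, (fun s => match s with inl i => a i | inr j => c j end),
  (fun s => match s with inl i => b i | inr j => e j end).
by split=> [[]//|[]//|z]; rewrite big_sumType FE GE.
Qed.

Let tensorM U V F G : zopen U -> zopen V -> tensor U V F -> tensor U V G ->
  tensor U V (fun z => F z * G z).
Proof.
move=> oU oV [I [a [b [ra rb FE]]]] [J [c [e [rc re GE]]]].
exists (I * J)%type, (fun s x => a s.1 x * c s.2 x), (fun s y => b s.1 y * e s.2 y).
split=> [s|s|z]; [exact: regularM|exact: regularM|].
rewrite FE GE big_distrlr /= pair_big /=.
by apply: eq_bigr => s _; rewrite mulrACA.
Qed.

Let tensor_sub U V U' V' F : zopen U -> zopen V -> zopen U' -> zopen V' ->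
  U' `<=` U -> V' `<=` V -> tensor U V F -> tensor U' V' F.
Proof.
move=> oU oV oU' oV' UU VV [I [a [b [ra rb FE]]]]; exists I, a, b; split=> // i.
  by apply: regular_sub (ra i).
by apply: regular_sub (rb i).
Qed.

Lemma prod_openT : prod_open setT.
Proof.
move=> z _; exists setT, setT, (fun=> 1); split=> //; last exact: oner_neq0.
  by split; exact: zopenT.
by apply: tensor_cst; exact: zopenT.
Qed.

Lemma prod_openI W1 W2 : prod_open W1 -> prod_open W2 -> prod_open (W1 `&` W2).
Proof.
move=> o1 o2 z [z1 z2].
have [U [V [F [[oU oV] [Uz Vz] tF Fz FW]]]] := o1 z z1.
have [U' [V' [F' [[oU' oV'] [Uz' Vz'] tF' Fz' FW']]]] := o2 z z2.
have oUU := zopenI oU oU'; have oVV := zopenI oV oV'.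
exists (U `&` U'), (V `&` V'), (fun w => F w * F' w); split=> //.
- apply: tensorM => //.
    by apply: tensor_sub tF => // ? [].
  by apply: tensor_sub tF' => // ? [].
- by rewrite mulf_neq0.
- move=> w [Uw Uw'] [Vw Vw']; rewrite mulf_eq0 negb_or => /andP[Fw Fw'].
  by split; [exact: FW|exact: FW'].
Qed.

Lemma prod_open_bigcup (I : Type) (W : I -> set (X * Y)) :
  (forall i, prod_open (W i)) -> prod_open (\bigcup_i W i).
Proof.
move=> oW z [i _ Wz]; have [U [V [F [oUV Uz tF Fz FW]]]] := oW i z Wz.
by exists U, V, F; split=> // w Uw Vw Fw; exists i => //; exact: FW.
Qed.

Lemma prod_regular_ext W f g : prod_open W ->
  (forall x, W x -> f x = g x) -> prod_regular W f -> prod_regular W g.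
Proof.
move=> _ fg rf z Wz; have [U [V [F [G [oUV Uz tF Gz fE]]]]] := rf z Wz.
by exists U, V, F, G; split=> // w Ww Uw Vw Gw; rewrite -fg// fE.
Qed.

Lemma prod_regular_sub W W' f : prod_open W -> prod_open W' -> W' `<=` W ->
  prod_regular W f -> prod_regular W' f.
Proof.
move=> _ _ WW rf z Wz; have [U [V [F [G [oUV Uz tF Gz fE]]]]] := rf z (WW _ Wz).
by exists U, V, F, G; split=> // w Ww; exact/fE/WW.
Qed.

Lemma prod_regular_glue W f : prod_open W ->
  (forall z, W z -> exists W',
     [/\ prod_open W', W' z, W' `<=` W & prod_regular W' f]) ->
  prod_regular W f.
Proof.
move=> _ loc z Wz; have [W' [oW' Wz' WW rf]] := loc z Wz.
have [U [V [F [G [[oU oV] [Uz Vz] [tF tG] Gz fE]]]]] := rf z Wz'.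
have [U' [V' [H [[oU' oV'] [Uz' Vz'] tH Hz HW]]]] := oW' z Wz'.
have oUU := zopenI oU oU'; have oVV := zopenI oV oV'.
have tH' : tensor (U `&` U') (V `&` V') H by apply: tensor_sub tH => // ? [].
exists (U `&` U'), (V `&` V'), (fun w => F w * H w), (fun w => G w * H w).
split=> //; last first.
- move=> w Ww [Uw Uw'] [Vw Vw']; rewrite mulf_eq0 negb_or => /andP[Gw Hw].
  by rewrite -mulf_div divff// mulr1; apply: fE => //; exact: HW.
- by rewrite mulf_neq0.
- by split; apply: tensorM => //; [apply: tensor_sub tF|apply: tensor_sub tG] => // ? [].
Qed.

Lemma prod_regular_cst W (a : K) : prod_open W -> prod_regular W (fun=> a).
Proof.
move=> _ z _; exists setT, setT, (fun=> a), (fun=> 1).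
split=> //; [by split; exact: zopenT| |exact: oner_neq0|by move=> *; rewrite divr1].
by split; apply: tensor_cst; exact: zopenT.
Qed.

Lemma prod_regularD W f g : prod_open W -> prod_regular W f ->
  prod_regular W g -> prod_regular W (fun x => f x + g x).
Proof.
move=> _ rf rg z Wz.
have [U [V [F [G [[oU oV] [Uz Vz] [tF tG] Gz fE]]]]] := rf z Wz.
have [U' [V' [F' [G' [[oU' oV'] [Uz' Vz'] [tF' tG'] Gz' gE]]]]] := rg z Wz.
have oUU := zopenI oU oU'; have oVV := zopenI oV oV'.
have sub1 H : tensor U V H -> tensor (U `&` U') (V `&` V') H.
  by apply: tensor_sub => // ? [].
have sub2 H : tensor U' V' H -> tensor (U `&` U') (V `&` V') H.
  by apply: tensor_sub => // ? [].
exists (U `&` U'), (V `&` V'), (fun w => F w * G' w + F' w * G w),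
  (fun w => G w * G' w).
split=> //; last first.
- move=> w Ww [Uw Uw'] [Vw Vw']; rewrite mulf_eq0 negb_or => /andP[Gw Gw'].
  by rewrite fE// gE// addf_div.
- by rewrite mulf_neq0.
- split; last by apply: tensorM; auto.
  by apply: tensorD; apply: tensorM; auto.
Qed.

Lemma prod_regularM W f g : prod_open W -> prod_regular W f ->
  prod_regular W g -> prod_regular W (fun x => f x * g x).
Proof.
move=> _ rf rg z Wz.
have [U [V [F [G [[oU oV] [Uz Vz] [tF tG] Gz fE]]]]] := rf z Wz.
have [U' [V' [F' [G' [[oU' oV'] [Uz' Vz'] [tF' tG'] Gz' gE]]]]] := rg z Wz.
have oUU := zopenI oU oU'; have oVV := zopenI oV oV'.
have sub1 H : tensor U V H -> tensor (U `&` U') (V `&` V') H.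
  by apply: tensor_sub => // ? [].
have sub2 H : tensor U' V' H -> tensor (U `&` U') (V `&` V') H.
  by apply: tensor_sub => // ? [].
exists (U `&` U'), (V `&` V'), (fun w => F w * F' w), (fun w => G w * G' w).
split=> //; last first.
- move=> w Ww [Uw Uw'] [Vw Vw']; rewrite mulf_eq0 negb_or => /andP[Gw Gw'].
  by rewrite fE// gE// mulf_div.
- by rewrite mulf_neq0.
- by split; apply: tensorM; auto.
Qed.

Definition product_space : space K :=
  Space prod_openT prod_openI prod_open_bigcup prod_regular_ext
    prod_regular_sub prod_regular_glue prod_regular_cst prod_regularD
    prod_regularM.

End Product.

Definition is_affine (K : closedFieldType) (X : space K) : Prop :=
  exists n (Z : set (affine_space K n)), zopen (~` Z) /\
    isomorphic X (induced_space Z).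

Definition is_variety (K : closedFieldType) (X : space K) : Prop :=
  (exists n (U : 'I_n -> set X),
     [/\ forall i, zopen (U i), forall i, is_affine (induced_space (U i)) &
         forall x, exists i, U i x]) /\
  zopen ([set z | z.1 <> z.2] : set (product_space X X)).

Section Bundles.
Variable K : closedFieldType.

Definition punctured_plane : space K :=
  induced_space ([set v | v != 0] : set (affine_space K 2)).
Notation B := punctured_plane.

Definition Ga : space K := affine_space K 1.
Definition Gm : space K :=
  induced_space ([set v | v 0 0 != 0] : set (affine_space K 1)).

(* [tau] is the fibre coordinate of a [Ga]-equivariant trivialization
   [(rho, tau)] of [rho] over [U], for the action [ga]. *)
Definition trivialization (X : space K) (rho : X -> B) (ga : K -> X -> X)
    (U : set B) (tau : X -> K) : Prop :=
  is_iso (fun x : induced_space (rho @^-1` U) =>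
            (exist U (rho (sval x)) (svalP x), const_mx (tau (sval x)))
          : product_space (induced_space U) Ga) /\
  forall t x, U (rho x) -> tau (ga t x) = tau x + t.

Record Ga_bundle := GaBundle {
  total_space :> space K;
  total_is_variety : is_variety total_space;
  rho : total_space -> B;
  rho_regular : regular_map rho;
  ga : K -> total_space -> total_space;
  ga_regular : regular_map
    (fun z : product_space Ga total_space => ga (z.1 0 0) z.2);
  ga0 : forall x, ga 0 x = x;
  gaD : forall s t x, ga (s + t) x = ga s (ga t x);
  rho_ga : forall t x, rho (ga t x) = rho x;
  locally_trivial : forall u : B, exists U tau,
    [/\ zopen U, U u & trivialization rho ga U tau]
}.

Definition trivial_bundle (P : Ga_bundle) : Prop :=
  exists tau, trivialization (@rho P) (@ga P) setT tau.

(* These are the preimages of the subsets of the projective line. *)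
Definition Gm_stable (U : set B) : Prop :=
  forall (lambda : K) (u v : B), lambda != 0 -> sval v = lambda *: sval u ->
    U u -> U v.

(* The sections of [O(-d)] over an open subset [V] of the projective line are
   the regular functions of degree [-d] on its preimage [U]. *)
Definition homogeneous_function (d : nat) (U : set B) (g : B -> K) : Prop :=
  regular_on U g /\
  forall (lambda : K) (u v : B), lambda != 0 -> sval v = lambda *: sval u ->
    U u -> g v = lambda ^- d * g u.

(* The isomorphism class of [P] in [H^1(B, O_B)] is the image of a Cech
   1-cocycle, with values in [O(-d)], of an open covering of the projective
   line. *)
Definition class_in_degree (d : nat) (P : Ga_bundle) : Prop :=
  exists (I : Type) (U : I -> set B) (tau : I -> P -> K) (g : I -> I -> B -> K),
    [/\ forall i, zopen (U i) /\ Gm_stable (U i),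
        forall u, exists i, U i u,
        forall i, trivialization (@rho P) (@ga P) (U i) (tau i),
        forall i j, homogeneous_function d (U i `&` U j) (g i j) &
        forall i j x, (U i `&` U j) (rho x) ->
          tau i x = tau j x + g i j (rho x)].

Definition homogeneous_bundle (d : nat) (P : Ga_bundle) : Prop :=
  ~ trivial_bundle P /\ class_in_degree d P.

(* Only the values of [Gm_act] at nonzero scalars are meaningful. *)
Record Gm_lift (P : Ga_bundle) := GmLift {
  Gm_act :> K -> P -> P;
  Gm_act_regular : regular_map
    (fun z : product_space Gm P => Gm_act (sval z.1 0 0) z.2);
  Gm_act1 : forall x, Gm_act 1 x = x;
  Gm_actM : forall lambda mu x, lambda != 0 -> mu != 0 ->
    Gm_act (lambda * mu) x = Gm_act lambda (Gm_act mu x);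
  rho_Gm_act : forall lambda x, lambda != 0 ->
    sval (rho (Gm_act lambda x)) = lambda *: sval (rho x)
}.

Definition homogeneous_lift (d : nat) (P : Ga_bundle) (s : Gm_lift P) : Prop :=
  exists (I : Type) (U : I -> set B) (tau : I -> P -> K),
    [/\ forall i,
          [/\ zopen (U i), is_affine (induced_space (U i)) & Gm_stable (U i)],
        forall u, exists i, U i u,
        forall i, trivialization (@rho P) (@ga P) (U i) (tau i) &
        forall i lambda x, lambda != 0 -> U i (rho x) ->
          tau i (s lambda x) = lambda ^- d * tau i x].

Definition equivariantly_isomorphic (P P' : Ga_bundle) (s : Gm_lift P)
    (s' : Gm_lift P') : Prop :=
  exists f : P -> P', is_iso f /\
    forall lambda x, lambda != 0 -> f (s lambda x) = s' lambda (f x).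

End Bundles.

(* Main.v *)
From mathcomp Require Import all_boot all_order all_algebra.
From mathcomp Require Import boolp classical_sets reals.
From mathcomp Require Import mpoly ring zify.
Require Import Defs.

(** Let [d >= 2] and [n = d - 1].  The proof compares every nontrivial homogeneous
    bundle of degree [-d] with one model, the affine hypersurface
    [x v - y^n u = 1] on which [Gm] acts with weights [1], [1], [-1], [-n].

    Existence of the isomorphism ([homogeneous_bundle_hypersurface]).  The chart
    [x != 0] of the projective line is an affine line, on which the class of the
    bundle vanishes ([chart_slices]); likewise for [y != 0].  The bundle [P] is
    therefore glued from two trivial pieces, with fibre coordinates [t0] and [t1]
    that differ by [x^-d] times a Laurent polynomial in [y / x]
    ([laurent_cocycle]).  For a linear form [l = y - s x], the product of [l^n]
    with the class lies in degree [-1], where the cohomology is zero.  Hence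
    [l^n t0] can be corrected to a function [V] of weight [-1] on all of [P].  On
    the line [l = 0] the function [V] is a constant [c] divided by [x]; up to sign,
    [c] is the product of the class with [l^(d-2)] in the one-dimensional space
    [H^1(P^1, O(-2))]; as the powers of linear forms span all forms, a nontrivial
    class has [c != 0] for some [s] ([generic_direction]).  For this [s] the pair
    [(l, V)] has no zero on [P], and away from [l = 0] it forms, together with
    [x], a system of coordinates.  Along [l = 0] the slope [l / x] is a power
    series in [l V] up to order [n] ([poly_inversion]), which means that [x V]
    is a polynomial [E (l V)] up to a multiple of [l^n].  All terms of [E] but
    the constant one are multiples of [V] and are absorbed by changing [x] into
    another function [x'] of weight [1].  Then [x' V] is a constant plus a
    multiple of [l^n], which is the equation of the model
    ([glued_isomorphic_hypersurface]).  Every step respects weights, so that the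
    isomorphism is equivariant for any homogeneous lift.

    Necessity of [d = d'] ([hypersurface_weight_eq]).  The volume form of the
    model has weight [1 - n], whence the Jacobian determinant of an equivariant
    isomorphism between the models for [n] and [m] is a nowhere vanishing
    function of weight [n - m].  Such a function is constant on affine lines, and
    these join any two points with the same [y != 0], or with the same [x != 0];
    it is therefore constant, and [n = m].  The determinant is that of the
    differential extended to the ambient space by an equivariant transversal
    field ([jacobian]).  Tangent vectors are derivations of germs of regular
    functions, so that no global equations for the isomorphism are required. *)

Set Implicit Arguments.
Unset Strict Implicit.
Unset Printing Implicit Defensive.

Import GRing.Theory.
Local Open Scope classical_set_scope.
Local Open Scope ring_scope.

(** * Local rings and gluing *)
Section Spaces.
Variable K : closedFieldType.
Implicit Types X Y W : space K.

(** A function germ that does not vanish at its point is invertible.  The axioms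
    of [space] do not imply this, but varieties have the property, and it is what
    makes a map into affine space regular as soon as its coordinates are. *)
Definition locally_ringed X : Prop :=
  forall (U : set X) (f : X -> K), zopen U -> regular_on U f ->
    zopen (U `&` [set x | f x != 0]) /\
    regular_on (U `&` [set x | f x != 0]) (fun x => (f x)^-1).

Lemma zopen_local X (U : set X) :
  (forall x, U x -> exists V, [/\ zopen V, V x & V `<=` U]) -> zopen U.
Proof.
move=> loc; have -> : U = \bigcup_(V : {V : set X | zopen V /\ V `<=` U}) sval V.
  apply/seteqP; split=> x.
    by move=> Ux; have [V [oV Vx VU]] := loc x Ux; exists (exist _ V (conj oV VU)).
  by move=> [[V [oV VU]] _ /VU].
by apply: zopen_bigcup => -[V []].
Qed.

Lemma regular_on_local X (U : set X) f : zopen U ->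
  (forall x, U x -> exists V g, [/\ zopen V, V x, regular_on V g &
     forall y, U y -> V y -> f y = g y]) -> regular_on U f.
Proof.
move=> oU loc; apply: regular_glue => // x Ux.
have [V [g [oV Vx rg fg]]] := loc x Ux; have oUV := zopenI oU oV.
exists (U `&` V); split=> //.
apply: (regular_ext oUV (f := g)); first by move=> y [Uy Vy]; rewrite fg.
by apply: (regular_sub oV oUV _ rg) => ? [].
Qed.

Lemma locally_ringed_affine n : locally_ringed (affine_space K n).
Proof.
move=> U f oU rf; split.
  apply: zopen_local => x [Ux fx0]; have [p [q [qx fE]]] := rf x Ux.
  exists (U `&` [set y | peval (p * q) y != 0]); split.
  - apply: zopenI => //; exists [set (p * q)]; apply/seteqP; split=> y /=.
      by move=> H; exists (p * q).
    by case=> _ ->.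
  - split=> //; rewrite /= [peval _ _]mevalM mulf_neq0//.
    by move: fx0; rewrite /= fE// mulf_eq0 negb_or => /andP[].
  - move=> y [Uy]; rewrite /= [peval _ _]mevalM mulf_eq0 negb_or => /andP[py qy].
    by split=> //=; rewrite fE// mulf_neq0// invr_neq0.
move=> x [Ux fx0]; have [p [q [qx fE]]] := rf x Ux.
exists (q * q), (p * q).
have px : peval p x != 0 by move: fx0; rewrite /= fE// mulf_eq0 negb_or => /andP[].
rewrite [peval _ _]mevalM mulf_neq0//; split=> // y [Uy fy].
rewrite ![peval (_ * _) _]mevalM mulf_eq0 negb_or => /andP[py qy].
by rewrite fE// invf_div -mulf_div divff// mulr1.
Qed.

Lemma locally_ringed_induced X (A : set X) :
  locally_ringed X -> locally_ringed (induced_space A).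
Proof.
move=> lX U f oU rf; split.
  apply: zopen_local => x [Ux fx0]; have [W [g [oW Wx rg fE]]] := rf x Ux.
  have [oWg _] := lX W g oW rg.
  exists (U `&` (@sval X A) @^-1` (W `&` [set y | g y != 0])); split.
  - by apply: zopenI => //; exists (W `&` [set y | g y != 0]).
  - by split=> //=; split=> //=; rewrite -fE.
  - by move=> y [Uy [Wy gy]]; split=> //=; rewrite fE.
move=> x [Ux fx0]; have [W [g [oW Wx rg fE]]] := rf x Ux.
have [oWg rgV] := lX W g oW rg.
exists (W `&` [set y | g y != 0]), (fun y => (g y)^-1); split=> //.
  by split=> //=; rewrite -fE.
by move=> y [Uy _] [Wy _]; rewrite fE.
Qed.

Lemma locally_ringed_product X Y : locally_ringed (product_space X Y).
Proof.
move=> W f oW rf.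
have D (U : set X) (V : set Y) F : zopen U -> zopen V -> tensor U V F ->
    prod_open [set w | [/\ U w.1, V w.2 & F w != 0]].
  move=> oU oV tF z [Uz Vz Fz]; exists U, V, F; split=> //.
have oWf : zopen (W `&` [set x | f x != 0] : set (product_space X Y)).
  apply: (@zopen_local (product_space X Y)) => z [Wz fz0].
  have [U [V [F [G [[oU oV] [Uz Vz] [tF tG] Gz fE]]]]] := rf z Wz.
  exists (W `&` ([set w | [/\ U w.1, V w.2 & F w != 0]] `&`
                 [set w | [/\ U w.1, V w.2 & G w != 0]])); split.
  - by apply: zopenI => //; apply: (@zopenI _ (product_space X Y)); exact: D.
  - split=> //; split; split=> //.
    by apply: contraNneq fz0 => F0; rewrite /= fE// F0 mul0r.
  - move=> w [Ww [[Uw Vw Fw] [_ _ Gw]]]; split=> //=.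
    by rewrite fE// mulf_neq0// invr_neq0.
split=> //; apply: regular_glue => // z [Wz fz0].
have [U [V [F [G [[oU oV] [Uz Vz] [tF tG] Gz fE]]]]] := rf z Wz.
have Fz : F z != 0 by apply: contraNneq fz0 => F0; rewrite /= fE// F0 mul0r.
exists ((W `&` [set x | f x != 0]) `&` [set w | [/\ U w.1, V w.2 & G w != 0]]).
split=> //.
  by apply: (@zopenI _ (product_space X Y)) => //; exact: D.
move=> w [[Ww fw0] [Uw Vw Gw]]; exists U, V, G, F; split=> //.
  by apply: contraNneq fw0 => F0; rewrite /= fE// F0 mul0r.
by move=> y [[Wy fy0] [Uy Vy Gy]] _ _ _; rewrite fE// invf_div.
Qed.

Lemma regular_map_sval X (A : set X) :
  regular_map (@sval X A : induced_space A -> X).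
Proof.
move=> V oV; split; first by exists V.
by move=> g rg x Vx; exists V, g.
Qed.

Lemma regular_map_comp X Y W (f : X -> Y) (g : Y -> W) :
  regular_map f -> regular_map g -> regular_map (g \o f).
Proof.
move=> rf rg V oV; have [oV' rgV] := rg V oV; have [oV'' rfV] := rf _ oV'.
by split=> // h rh; exact: (rfV _ (rgV h rh)).
Qed.

Lemma regular_map_ext X Y (f g : X -> Y) :
  f =1 g -> regular_map f -> regular_map g.
Proof. by move=> /funext ->. Qed.

Lemma regular_on_of_induced X (O V : set X) (f : X -> K) :
  zopen O -> zopen V -> V `<=` O ->
  regular_on ((@sval X O) @^-1` V : set (induced_space O)) (f \o sval) ->
  regular_on V f.
Proof.
move=> oO oV VO rf; apply: regular_on_local => // x Vx.
have [W [g [oW Wx rg fE]]] := rf (exist _ x (VO _ Vx)) Vx.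
exists W, g; split=> // y Vy Wy.
exact: (fE (exist _ y (VO _ Vy)) Vy Wy).
Qed.

Lemma regular_map_local X Y (f : X -> Y) :
  (forall x, exists O, [/\ zopen O, O x &
     regular_map (f \o sval : induced_space O -> Y)]) -> regular_map f.
Proof.
move=> loc V oV.
have oP : zopen (f @^-1` V).
  apply: zopen_local => x Vx; have [O [oO Ox rf]] := loc x.
  have [[W oW WE] _] := rf V oV.
  have WP y (Oy : O y) : W y = V (f y).
    by have := congr1 (fun S : set _ => S (exist _ y Oy)) WE.
  exists (O `&` W); split; [exact: zopenI|by rewrite /setI /= WP|].
  by move=> y [Oy]; rewrite /= WP.
split=> // g rg; apply: regular_glue => // x Vx.
have [O [oO Ox rf]] := loc x; have [_ rgV] := rf V oV.
have oOV := zopenI oO oP; exists (O `&` f @^-1` V); split=> //.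
apply: (regular_on_of_induced oO) => //.
have -> : (@sval X O) @^-1` (O `&` f @^-1` V) = (f \o @sval X O) @^-1` V.
  by apply/seteqP; split=> [y []|[y Oy] Vy].
exact: rgV.
Qed.

Lemma regular_map_induced X Y (A : set Y) (f : X -> induced_space A) :
  regular_map (sval \o f : X -> Y) -> regular_map f.
Proof.
move=> rf V [W oW VE]; have [oW' rfW] := rf W oW.
have oV : zopen (f @^-1` V) by rewrite VE.
split=> // g rg; apply: regular_on_local => // x Vx.
have [W' [h [oW'' Wx rh gE]]] := rg (f x) Vx.
have [oW3 rfW'] := rf W' oW''.
exists ((sval \o f) @^-1` W'), (h \o (sval \o f)); split=> //; first exact: rfW'.
by move=> y; exact: gE.
Qed.

Lemma regular_map_fst X Y : regular_map (fst : product_space X Y -> X).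
Proof.
move=> U oU; have t1 V (h : X -> K) : zopen V -> regular_on V h ->
    tensor V setT (fun z : X * Y => h z.1).
  move=> oV rh; exists unit, (fun=> h), (fun=> fun=> 1).
  split=> [_|_|z]; [exact: rh|exact/regular_cst/zopenT|].
  by rewrite big_const card_unit /= addr0 mulr1.
have oT := zopenT Y.
split.
  move=> z Uz; exists U, setT, (fun=> 1).
  split; [by []|by []| |exact: oner_neq0|by []].
  by apply: (t1 U (fun=> 1)) => //; exact: regular_cst.
move=> h rh; change (prod_regular (fst @^-1` U) (h \o fst : X * Y -> K)) => z Uz.
exists U, setT, (fun z => h z.1), (fun=> 1).
split; [by []|by []| |exact: oner_neq0|by move=> *; rewrite divr1].
by split; [exact: t1|apply: (t1 U (fun=> 1)) => //; exact: regular_cst].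
Qed.

Lemma regular_map_snd X Y : regular_map (snd : product_space X Y -> Y).
Proof.
move=> U oU; have t1 V (h : Y -> K) : zopen V -> regular_on V h ->
    tensor setT V (fun z : X * Y => h z.2).
  move=> oV rh; exists unit, (fun=> fun=> 1), (fun=> h).
  split=> [_|_|z]; [exact/regular_cst/zopenT|exact: rh|].
  by rewrite big_const card_unit /= addr0 mul1r.
have oT := zopenT X.
split.
  move=> z Uz; exists setT, U, (fun=> 1).
  split; [by []|by []| |exact: oner_neq0|by []].
  by apply: (t1 U (fun=> 1)) => //; exact: regular_cst.
move=> h rh; change (prod_regular (snd @^-1` U) (h \o snd : X * Y -> K)) => z Uz.
exists setT, U, (fun z => h z.2), (fun=> 1).
split; [by []|by []| |exact: oner_neq0|by move=> *; rewrite divr1].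
by split; [exact: t1|apply: (t1 U (fun=> 1)) => //; exact: regular_cst].
Qed.

Lemma regular_on_sum X (U : set X) (I : Type) (r : seq I) (F : I -> X -> K) :
  zopen U -> (forall i, regular_on U (F i)) ->
  regular_on U (fun x => \sum_(i <- r) F i x).
Proof.
move=> oU rF; elim: r => [|i r IHr].
  by apply: regular_ext (regular_cst 0 oU) => // x _; rewrite big_nil.
by apply: regular_ext (regularD oU (rF i) IHr) => // x _; rewrite big_cons.
Qed.

Lemma regular_on_prod X (U : set X) (I : Type) (r : seq I) (F : I -> X -> K) :
  zopen U -> (forall i, regular_on U (F i)) ->
  regular_on U (fun x => \prod_(i <- r) F i x).
Proof.
move=> oU rF; elim: r => [|i r IHr].
  by apply: regular_ext (regular_cst 1 oU) => // x _; rewrite big_nil.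
by apply: regular_ext (regularM oU (rF i) IHr) => // x _; rewrite big_cons.
Qed.

Lemma regular_onX X (U : set X) (f : X -> K) n :
  zopen U -> regular_on U f -> regular_on U (fun x => f x ^+ n).
Proof.
move=> oU rf; elim: n => [|n IHn]; first exact: regular_cst.
by apply: regular_ext (regularM oU rf IHn) => // x _; rewrite exprS.
Qed.

Lemma regular_onN X (U : set X) (f : X -> K) :
  zopen U -> regular_on U f -> regular_on U (fun x => - f x).
Proof.
move=> oU rf; apply: regular_ext (regularM oU (regular_cst (-1) oU) rf) => // x _.
by rewrite mulN1r.
Qed.

Lemma regular_onB X (U : set X) (f g : X -> K) : zopen U ->
  regular_on U f -> regular_on U g -> regular_on U (fun x => f x - g x).
Proof. by move=> oU rf rg; apply: regularD => //; exact: regular_onN. Qed.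

Lemma regular_on_horner X (U : set X) (f : X -> K) (p : {poly K}) :
  zopen U -> regular_on U f -> regular_on U (fun x => p.[f x]).
Proof.
move=> oU rf; have r1 (i : 'I_(size p)) : regular_on U (fun x => p`_i * f x ^+ i).
  by apply: regularM => //; [exact: regular_cst|exact: regular_onX].
by apply: regular_ext (regular_on_sum _ oU r1) => // x _; rewrite horner_coef.
Qed.

Lemma regular_on_meval X (U : set X) n (f : 'I_n -> X -> K) (p : {mpoly K[n]}) :
  zopen U -> (forall i, regular_on U (f i)) ->
  regular_on U (fun x => p.@[fun i => f i x]).
Proof.
move=> oU rf.
have r1 m : regular_on U (fun x => p@_m * \prod_i f i x ^+ m i).
  apply: regularM => //; first exact: regular_cst.
  by apply: regular_on_prod => // i; exact: regular_onX.
by apply: regular_ext (regular_on_sum _ oU r1) => // x _; rewrite mevalE.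
Qed.

Lemma zopen_neq0 X (U : set X) (f : X -> K) : locally_ringed X ->
  zopen U -> regular_on U f -> zopen (U `&` [set x | f x != 0]).
Proof. by move=> lX oU rf; case: (lX U f oU rf). Qed.

Lemma regular_onV X (U : set X) (f : X -> K) : locally_ringed X ->
  zopen U -> regular_on U f -> (forall x, U x -> f x != 0) ->
  regular_on U (fun x => (f x)^-1).
Proof.
move=> lX oU rf f0; have [_] := lX U f oU rf.
by have -> : U `&` [set x | f x != 0] = U by apply/seteqP; split=> x => [[]|/[dup] /f0].
Qed.

Lemma regular_on_div X (U : set X) (f g : X -> K) : locally_ringed X ->
  zopen U -> regular_on U f -> regular_on U g -> (forall x, U x -> g x != 0) ->
  regular_on U (fun x => f x / g x).
Proof. by move=> lX oU rf rg g0; apply: regularM => //; exact: regular_onV. Qed.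

Lemma regular_on_coord n (U : set (affine_space K n)) i : zopen U ->
  regular_on U (fun x : affine_space K n => x 0 i).
Proof.
move=> oU; change (affine_regular U (fun x => x 0 i)) => x _.
exists 'X_i, 1; rewrite /peval meval1 oner_neq0; split=> // y _ _.
by rewrite meval1 divr1 mevalXU.
Qed.

Lemma regular_map_affine X n (f : X -> affine_space K n) : locally_ringed X ->
  (forall i, regular_on setT (fun x => f x 0 i)) -> regular_map f.
Proof.
move=> lX rf; have oT := zopenT X.
have rp p : regular_on setT (fun x => peval p (f x)) by exact: regular_on_meval.
have op p : zopen [set x | peval p (f x) != 0].
  by rewrite -[X in zopen X]setTI; exact: zopen_neq0.
move=> V [S VE]; have oV : zopen (f @^-1` V).
  rewrite VE; apply: zopen_local => x [p Sp px].
  by exists [set x | peval p (f x) != 0]; split=> // y py; exists p.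
split=> // g rg; apply: regular_on_local => // x Vx.
have [p [q [qx gE]]] := rg (f x) Vx.
exists [set x | peval q (f x) != 0], (fun x => peval p (f x) / peval q (f x)).
split=> //; last by move=> y Vy qy; rewrite /= gE.
by apply: regular_on_div => //; apply: (regular_sub oT).
Qed.

Lemma regular_map_product X Y W (f : W -> product_space X Y) : locally_ringed W ->
  regular_map (fst \o f) -> regular_map (snd \o f) -> regular_map f.
Proof.
move=> lW r1 r2.
have rt (U : set X) (V : set Y) F : zopen U -> zopen V -> tensor U V F ->
    zopen (f @^-1` (U `*` V)) /\ regular_on (f @^-1` (U `*` V)) (F \o f).
  move=> oU oV [I [a [b [ra rb FE]]]].
  have [oU' rU] := r1 U oU; have [oV' rV] := r2 V oV.
  have oUV : zopen (f @^-1` (U `*` V)).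
    exact: (zopenI oU' oV').
  split=> //.
  have rs i : regular_on (f @^-1` (U `*` V)) (fun w => a i (f w).1 * b i (f w).2).
    apply: regularM => //.
      by apply: (regular_sub oU' oUV _ (rU _ (ra i))) => w [].
    by apply: (regular_sub oV' oUV _ (rV _ (rb i))) => w [].
  by apply: regular_ext (regular_on_sum _ oUV rs) => // w _; rewrite /= FE.
move=> V oV; have oV' : zopen (f @^-1` V).
  apply: zopen_local => w Vw; have [A [B [F [[oA oB] [Aw Bw] tF Fw FV]]]] := oV _ Vw.
  have [oAB rAB] := rt A B F oA oB tF.
  exists (f @^-1` (A `*` B) `&` [set w | F (f w) != 0]).
  split; [exact: (zopen_neq0 lW oAB rAB)|by []|].
  by move=> y [[Ay By] Fy]; exact: FV.
split=> // g rg; apply: regular_on_local => // w Vw.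
have [A [B [F [G [[oA oB] [Aw Bw] [tF tG] Gw gE]]]]] := rg _ Vw.
have [oAB rF] := rt A B F oA oB tF; have [_ rG] := rt A B G oA oB tG.
have oABG := zopen_neq0 lW oAB rG.
exists (f @^-1` (A `*` B) `&` [set w | G (f w) != 0]), (fun w => F (f w) / G (f w)).
split=> //; last by move=> y Vy [[Ay By] Gy]; rewrite /= gE.
apply: regular_on_div => //; last by move=> ? [].
  by apply: (regular_sub oAB oABG _ rF) => ? [].
by apply: (regular_sub oAB oABG _ rG) => ? [].
Qed.

Lemma locally_ringed_isomorphic X Y :
  isomorphic X Y -> locally_ringed Y -> locally_ringed X.
Proof.
move=> [f [rf [g [rg fK gK]]]] lY U h oU rh.
have [oU' rU] := rg U oU; have [oh rhV] := lY _ _ oU' (rU h rh).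
have -> : U `&` [set x | h x != 0] = f @^-1` (g @^-1` U `&` [set x | (h \o g) x != 0]).
  by apply/seteqP; split=> x; rewrite /setI /= fK.
have [of1 rf1] := rf _ oh; split=> //.
by apply: regular_ext (rf1 _ rhV) => // x _; rewrite /= fK.
Qed.

Lemma locally_ringed_variety X : is_variety X -> locally_ringed X.
Proof.
move=> [[n [U [oU aU covU]]] _].
have lU i : locally_ringed (induced_space (U i)).
  have [m [Z [_ iZ]]] := aU i.
  exact/(locally_ringed_isomorphic iZ)/locally_ringed_induced/locally_ringed_affine.
move=> V f oV rf.
have rs i : zopen ((@sval X (U i)) @^-1` V : set (induced_space (U i))) /\
    regular_on ((@sval X (U i)) @^-1` V : set (induced_space (U i))) (f \o sval).
  by have [? H] := @regular_map_sval _ (U i) _ oV; split=> //; exact: H.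
have oV' : zopen (V `&` [set x | f x != 0]).
  apply: zopen_local => x [Vx fx]; have [i Ui] := covU x.
  have [o1 r1] := rs i; have [[W oW WE] _] := lU i _ _ o1 r1.
  have WP y (Uy : U i y) : W y = (V y /\ f y != 0).
    by have := congr1 (fun S : set _ => S (exist _ y Uy)) WE.
  exists (U i `&` W); split; [exact: zopenI|by rewrite /setI /= WP|].
  by move=> y [Uy]; rewrite /= WP.
split=> //; apply: regular_glue => // x [Vx fx]; have [i Ui] := covU x.
have [o1 r1] := rs i; have [o2 r2] := lU i _ _ o1 r1.
exists (U i `&` (V `&` [set x | f x != 0])); have o3 := zopenI (oU i) oV'.
split=> //.
apply: (regular_on_of_induced (oU i)) => //.
suff -> : (@sval X (U i)) @^-1` (U i `&` (V `&` [set x | f x != 0])) =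
   (@sval X (U i)) @^-1` V `&` [set x | (f \o sval) x != 0] by [].
by apply/seteqP; split=> -[y Uy] //= [].
Qed.

End Spaces.

(** * Regular functions of one variable *)
Section Line.
Variable K : closedFieldType.
Implicit Types (f g : K -> K) (p q r : {poly K}) (X : space K).

(** Regularity of [f] at the point [z0] of the affine line.  The quotient must
    represent [f] wherever [q] does not vanish, so that the neighbourhood of
    [z0] on which [f] is a fraction need not be mentioned. *)
Definition regular_at f (z0 : K) : Prop :=
  exists p q, q.[z0] != 0 /\ forall z, q.[z] != 0 -> f z = p.[z] / q.[z].

Lemma poly_eq0_on_open p q : q != 0 -> (forall z, q.[z] != 0 -> p.[z] = 0) -> p = 0.
Proof.
move=> q0 p0; suff: p * q == 0 by rewrite mulf_eq0 (negPf q0) orbF => /eqP.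
apply/negPn/negP => /closed_nonrootP[z]; rewrite rootE hornerM.
by have [->|/p0 ->] := eqVneq q.[z] 0; rewrite ?mulr0 ?mul0r eqxx.
Qed.

Lemma poly_neq0_horner q z : q.[z] != 0 -> q != 0.
Proof. by apply: contraNneq => ->; rewrite horner0. Qed.

Lemma regular_at_ext f g r z0 : r.[z0] != 0 ->
  (forall z, r.[z] != 0 -> f z = g z) -> regular_at f z0 -> regular_at g z0.
Proof.
move=> r0 fg [p [q [q0 fE]]]; exists (p * r), (q * r).
rewrite hornerM mulf_neq0//; split=> // z; rewrite !hornerM mulf_eq0 negb_or.
by case/andP=> qz rz; rewrite -fg// fE// -mulf_div divff// mulr1.
Qed.

Lemma regular_at_horner p z0 : regular_at (horner p) z0.
Proof.
by exists p, 1; rewrite hornerC oner_neq0; split=> // z _; rewrite hornerC divr1.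
Qed.

Lemma regular_at_div p q z0 : q.[z0] != 0 ->
  regular_at (fun z => p.[z] / q.[z]) z0.
Proof. by move=> q0; exists p, q. Qed.

Lemma regular_atD f g z0 : regular_at f z0 -> regular_at g z0 ->
  regular_at (fun z => f z + g z) z0.
Proof.
move=> [p [q [q0 fE]]] [r [s [s0 gE]]]; exists (p * s + r * q), (q * s).
rewrite hornerM mulf_neq0//; split=> // z; rewrite hornerD !hornerM mulf_eq0 negb_or.
by case/andP=> qz sz; rewrite fE// gE// addf_div.
Qed.

Lemma regular_atM f g z0 : regular_at f z0 -> regular_at g z0 ->
  regular_at (fun z => f z * g z) z0.
Proof.
move=> [p [q [q0 fE]]] [r [s [s0 gE]]]; exists (p * r), (q * s).
rewrite hornerM mulf_neq0//; split=> // z; rewrite !hornerM mulf_eq0 negb_or.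
by case/andP=> qz sz; rewrite fE// gE// mulf_div.
Qed.

Lemma regular_atN f z0 : regular_at f z0 -> regular_at (fun z => - f z) z0.
Proof.
move=> [p [q [q0 fE]]]; exists (- p), q; split=> // z qz.
by rewrite hornerN fE// mulNr.
Qed.

(** In the coordinate [z^-1] a fraction is still a fraction, after numerator and
    denominator have been multiplied by the same power of [z]. *)
Lemma regular_at_inv f z0 : z0 != 0 -> regular_at f z0^-1 ->
  regular_at (fun z => f z^-1) z0.
Proof.
move=> z00 [p [q [q0 fE]]].
have rev_poly r N : (size r <= N)%N -> exists r', forall z, z != 0 ->
    r'.[z] = z ^+ N * r.[z^-1].
  move=> rN; exists (\sum_(i < N) r`_i *: 'X^(N - i)) => z zn0.
  rewrite (horner_coef_wide _ rN) horner_sum mulr_sumr.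
  apply: eq_bigr => i _; rewrite hornerZ hornerXn exprVn mulrCA; congr (_ * _).
  by rewrite expfB_cond // (negPf zn0) add0n ltnW.
have [p' pE] := rev_poly p _ (leq_maxl (size p) (size q)).
have [q' qE] := rev_poly q _ (leq_maxr (size p) (size q)).
exists (p' * 'X), (q' * 'X); rewrite hornerM hornerX qE//.
split=> [|z]; first by rewrite !mulf_neq0 ?expf_neq0.
rewrite !hornerM hornerX mulf_eq0 negb_or => /andP[qz zn0].
move: qz; rewrite qE// mulf_eq0 negb_or => /andP[zN qz].
by rewrite fE// pE// -mulf_div divff// mulr1 -mulf_div divff// mul1r.
Qed.

(** A function regular off [S] is a fraction in lowest terms, and since it is
    regular at [z], the reduced denominator cannot vanish at [z]. *)
Lemma regular_at_fraction (S : set K) f z1 :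
  (forall z, ~ S z -> regular_at f z) -> ~ S z1 ->
  exists p q, [/\ coprimep p q, forall z, ~ S z -> q.[z] != 0 &
    forall z, ~ S z -> f z = p.[z] / q.[z]].
Proof.
move=> rf S1; have [p1 [q1 [q10 f1]]] := rf z1 S1.
have q1n := poly_neq0_horner q10.
set g := gcdp p1 q1; have gn : g != 0 by rewrite gcdp_eq0 negb_and q1n orbT.
set p := p1 %/ g; set q := q1 %/ g.
have pE : p1 = p * g by rewrite divpK// dvdp_gcdl.
have qE : q1 = q * g by rewrite divpK// dvdp_gcdr.
have copq : coprimep p q by rewrite coprimep_div_gcd// q1n orbT.
have loc z : ~ S z -> exists p2 q2, [/\ q2.[z] != 0, f z = p2.[z] / q2.[z] &
    p * q2 = p2 * q].
  move=> Sz; have [p2 [q2 [q20 f2]]] := rf z Sz; have q2n := poly_neq0_horner q20.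
  exists p2, q2; split=> //; first exact: f2.
  apply/eqP; rewrite -subr_eq0; apply/eqP.
  apply: (poly_eq0_on_open (q := q1 * q2)); first by rewrite mulf_neq0.
  move=> t; rewrite hornerM mulf_eq0 negb_or => /andP[q1t q2t].
  have := f1 t q1t; rewrite f2// pE qE !hornerM.
  have [gt qt] : g.[t] != 0 /\ q.[t] != 0.
    by move: q1t; rewrite qE hornerM mulf_eq0 negb_or => /andP[].
  move/eqP; rewrite -mulf_div divff// mulr1 eqr_div// => /eqP E.
  by rewrite hornerD hornerN !hornerM E subrr.
have qn0 z : ~ S z -> q.[z] != 0.
  move=> /loc[p2 [q2 [q20 _ E]]]; apply/negP => /eqP qz.
  have := congr1 (fun r => r.[z]) E; rewrite !hornerM qz mulr0 => /eqP.
  rewrite mulf_eq0 (negPf q20) orbF => pz.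
  by have := coprimep_root copq pz; rewrite qz eqxx.
exists p, q; split=> // z Sz; have [p2 [q2 [q20 -> E]]] := loc z Sz.
apply/eqP; rewrite eqr_div// ?qn0//.
by have := congr1 (fun r => r.[z]) E; rewrite !hornerM => ->.
Qed.

Lemma poly_no_root q : (forall z, q.[z] != 0) -> exists c, q = c%:P.
Proof.
move=> q0; exists q`_0; apply: size1_polyC; rewrite leqNgt; apply/negP => sq.
have [|z /rootP qz] := closed_rootP q _; first by rewrite gtn_eqF.
by have := q0 z; rewrite qz eqxx.
Qed.

(** Both terms of the reduced fraction have no root, hence are constant. *)
Lemma regular_unit_const f : (forall z, regular_at f z) -> (forall z, f z != 0) ->
  forall z, f z = f 0.
Proof.
move=> rf f0; have [|//|p [q [_ qn fE]]] := @regular_at_fraction set0 f 0.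
  by move=> z _; exact: rf.
have [z|c qE] := poly_no_root (q := q); first exact: qn.
have [z|e pE] := poly_no_root (q := p).
  by have := f0 z; rewrite fE// mulf_eq0 negb_or => /andP[].
by move=> z; rewrite !fE// pE qE !hornerC.
Qed.

Lemma regular_laurent f M : (forall z, z != 0 -> regular_at f z) ->
  exists N p, (M <= N)%N /\ forall z, z != 0 -> f z = p.[z] / z ^+ N.
Proof.
move=> rf; have [||p [q [_ qn fE]]] := @regular_at_fraction [set 0] f 1.
- by move=> z /eqP; exact: rf.
- by apply/eqP; exact: oner_neq0.
have q0 : q != 0 by apply: (poly_neq0_horner (z := 1)); apply/qn/eqP/oner_neq0.
have [m [r /implyP/(_ q0) r0 qE]] := multiplicity_XsubC q 0.
have hq z : q.[z] = r.[z] * z ^+ m.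
  by rewrite qE hornerM horner_exp hornerXsubC subr0.
have [z|c rE] := poly_no_root (q := r).
  have [-> //|zn] := eqVneq z 0.
  by have := qn z (elimN eqP zn); rewrite hq mulf_eq0 negb_or => /andP[].
have c0 : c != 0 by move: r0; rewrite rE /root hornerC.
exists (M + m)%N, (c^-1 *: p * 'X^M); split=> [|z zn]; first exact: leq_addr.
rewrite fE; last exact/eqP.
rewrite hq rE hornerC hornerM hornerZ hornerXn exprD.
by field; rewrite c0 !expf_neq0.
Qed.

(** ** Restriction to curves *)

Definition regular_curve X (c : K -> X) : Prop :=
  regular_map (fun t : affine_space K 1 => c (t 0 0)).

Lemma meval_curve n (h : 'I_n -> {poly K}) (P : {mpoly K[n]}) :
  exists p, forall z, p.[z] = P.@[fun i => (h i).[z]].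
Proof.
exists (mmap (@polyC K) h P) => z.
rewrite mevalE /mmap horner_sum; apply: eq_bigr => m _.
rewrite hornerM hornerC; congr (_ * _); rewrite horner_prod.
by apply: eq_bigr => i _; rewrite horner_exp.
Qed.

Lemma peval_line (P : {mpoly K[1]}) :
  exists p, forall z, p.[z] = peval P (const_mx z).
Proof.
have [p pE] := meval_curve (fun=> 'X) P; exists p => z; rewrite pE.
by apply: meval_eq => i; rewrite hornerX mxE.
Qed.

Lemma regular_curve_open X (c : K -> X) (U : set X) z0 :
  regular_curve c -> zopen U -> U (c z0) ->
  exists r, r.[z0] != 0 /\ forall z, r.[z] != 0 -> U (c z).
Proof.
move=> rc oU Uz; have [[S SE] _] := rc U oU.
have UE z : U (c z) = (exists2 p, S p & peval p (const_mx z) != 0).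
  by have := congr1 (fun A : set _ => A (const_mx z)) SE; rewrite /= mxE.
move: Uz; rewrite UE => -[P SP Pz]; have [p pE] := peval_line P.
by exists p; rewrite pE; split=> // z; rewrite pE UE => Pz'; exists P.
Qed.

Lemma regular_at_curve X (c : K -> X) (U : set X) (f : X -> K) z0 :
  regular_curve c -> zopen U -> regular_on U f -> U (c z0) ->
  regular_at (f \o c) z0.
Proof.
move=> rc oU rf Uz; have [r [r0 rU]] := regular_curve_open rc oU Uz.
have [_ /(_ f rf) rfc] := rc U oU.
change (affine_regular ((fun t => c (t 0 0)) @^-1` U)
  (f \o (fun t : 'rV[K]_1 => c (t 0 0)))) in rfc.
have [|P [Q [Q0 fE]]] := rfc (const_mx z0); first by rewrite /= mxE.
have [[p pE] [q qE]] := (peval_line P, peval_line Q).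
apply: (regular_at_ext r0 (f := fun z => if r.[z] != 0 then (f \o c) z else p.[z] / q.[z])).
  by move=> z ->.
exists p, q; rewrite qE; split=> // z qz; case: ifP => // rz.
by have := fE (const_mx z); rewrite /= !mxE -qE -pE; apply=> //; exact: rU.
Qed.

Lemma regular_on_regular_at X (U : set X) (f : X -> K) (h : K -> K) :
  locally_ringed X -> zopen U -> regular_on U f ->
  (forall x, U x -> regular_at h (f x)) -> regular_on U (h \o f).
Proof.
move=> lX oU rf rh; apply: regular_on_local => // x Ux.
have [p [q [q0 hE]]] := rh x Ux.
have rp r : regular_on U (fun x => r.[f x]) by exact: regular_on_horner.
have oq := zopen_neq0 lX oU (rp q).
exists (U `&` [set x | q.[f x] != 0]), (fun x => p.[f x] / q.[f x]).
split=> //; last by move=> y Uy [_ qy]; rewrite /= hE.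
apply: regular_on_div => //; last by move=> ? [].
  exact: (regular_sub oU oq _ (rp p)).
exact: (regular_sub oU oq _ (rp q)).
Qed.

End Line.

(** * Fibre coordinates of a bundle *)
Section Charts.
Variables (K : closedFieldType) (P : Ga_bundle K).
Notation B := (punctured_plane K).
Implicit Types (U V : set B) (tau sigma : P -> K).

(** The form of a trivialization [(rho, tau)] over [U] that can be checked
    locally on [U]: instead of an inverse isomorphism, it asks that a map into
    [P] over [U] be regular as soon as its base point and its fibre coordinate
    are. *)
Definition chart U tau : Prop :=
  [/\ zopen U, regular_on (@rho _ P @^-1` U) tau,
      forall t x, U (rho x) -> tau (ga t x) = tau x + t &
      forall (W : space K) (f : W -> P), locally_ringed W ->
        regular_map (@rho _ P \o f) -> (forall w, U (rho (f w))) ->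
        regular_on setT (tau \o f) -> regular_map f].

Lemma locally_ringed_bundle : locally_ringed P.
Proof. exact/locally_ringed_variety/total_is_variety. Qed.

Lemma locally_ringed_base : locally_ringed B.
Proof. exact/locally_ringed_induced/locally_ringed_affine. Qed.

Lemma zopen_rho U : zopen U -> zopen (@rho _ P @^-1` U).
Proof. by move=> oU; case: (rho_regular P oU). Qed.

Lemma trivialization_chart U tau :
  zopen U -> trivialization (@rho _ P) (@ga _ P) U tau -> chart U tau.
Proof.
move=> oU [[]]; set Phi := (X in regular_map X) => rPhi [g [rg PhiK gK]] tauD.
have oU' := zopen_rho oU; split=> //.
- apply: (regular_on_of_induced oU') => //.
  have [_ /(_ (fun x => x 0 0))] := regular_map_comp rPhi
    (@regular_map_snd _ (induced_space U) (Ga K)) (zopenT (Ga K)).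
  have r0 : regular_on setT (fun x : Ga K => x 0 0) by exact/regular_on_coord/zopenT.
  move=> /(_ r0) r1.
  have -> : @sval P (@rho _ P @^-1` U) @^-1` (@rho _ P @^-1` U) = setT.
    by apply/seteqP; split=> // -[].
  by apply: regular_ext r1 => [|x _]; [exact: zopenT|rewrite /= mxE].
- move=> W f lW rf fU rtau.
  pose k (w : W) : product_space (induced_space U) (Ga K) :=
    (exist U (rho (f w)) (fU w), const_mx (tau (f w))).
  have rk : regular_map k.
    apply: regular_map_product => //; first exact: regular_map_induced.
    apply: regular_map_affine => // i.
    by apply: regular_ext rtau => [|w _]; [exact: zopenT|rewrite /= mxE].
  apply: regular_map_ext (regular_map_comp (regular_map_comp rk rg)
    (@regular_map_sval _ _ _)) => w /=.
  suff -> : k w = Phi (exist _ (f w) (fU w)) by rewrite PhiK.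
  by congr pair; exact: eq_exist.
Qed.

Lemma rho_surjective u : exists x : P, rho x = u.
Proof.
have [U [tau [_ Uu [[_ [g [_ _ gK]]] _]]]] := @locally_trivial _ P u.
exists (sval (g (exist _ u Uu, 0))).
by have := congr1 (fun z => sval z.1) (gK (exist _ u Uu, 0)).
Qed.

Lemma ga_transitive (x y : P) : rho x = rho y -> exists t, y = ga t x.
Proof.
move=> xy; have [U [tau [_ Uu [[_ [g [_ gK _]]] tauD]]]] := @locally_trivial _ P (rho x).
exists (tau y - tau x).
have Uy : U (rho y) by rewrite -xy.
have Ux : U (rho (ga (tau y - tau x) x)) by rewrite rho_ga.
suff /(congr1 (@sval _ _)) : exist (fun z => U (rho z)) y Uy = exist _ _ Ux by [].
apply: (can_inj gK) => /=; congr pair; last by rewrite tauD// addrC subrK.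
by apply: eq_exist => /=; rewrite rho_ga.
Qed.

Lemma chartS U V tau : zopen V -> V `<=` U -> chart U tau -> chart V tau.
Proof.
move=> oV VU [oU rtau tauD lift]; split=> //.
- by apply: (regular_sub (zopen_rho oU) (zopen_rho oV)) => // x; exact: VU.
- by move=> t x Vx; apply: tauD; exact: VU.
- by move=> W f lW rf fV; apply: lift => // w; exact: VU.
Qed.

Lemma regular_map_bundle (W : space K) (f : W -> P) : locally_ringed W ->
  regular_map (@rho _ P \o f) ->
  (forall w, exists O U tau, [/\ zopen O, O w, chart U tau,
     forall y, O y -> U (rho (f y)) & regular_on O (tau \o f)]) ->
  regular_map f.
Proof.
move=> lW rf loc; apply: regular_map_local => w.
have [O [U [tau [oO Ow [_ _ _ lift] OU rtau]]]] := loc w.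
exists O; split=> //; have rsval := @regular_map_sval _ W O.
apply: lift.
- exact: locally_ringed_induced.
- exact: (regular_map_comp rsval rf).
- by case=> y Oy; exact: OU.
- have [oE /(_ _ rtau)] := rsval _ oO.
  by apply: regular_sub => [//||[]//]; exact: zopenT.
Qed.

Lemma chart_local U tau : zopen U ->
  (forall u, U u -> exists V sigma h, [/\ V u, chart V sigma, regular_on V h &
     forall x, U (rho x) -> V (rho x) -> tau x = sigma x + h (rho x)]) ->
  chart U tau.
Proof.
move=> oU loc; split=> //.
- apply: regular_on_local => [|x Ux]; first exact: zopen_rho.
  have [V [sigma [h [Vx [oV rs _ _] rh E]]]] := loc _ Ux.
  have [oV' rV] := rho_regular P oV.
  exists (@rho _ P @^-1` V), (fun x => sigma x + h (rho x)); split=> //.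
  by apply: regularD => //; exact: rV.
- move=> t x Ux; have [V [sigma [h [Vx [_ _ sD _] _ E]]]] := loc _ Ux.
  by rewrite !E ?rho_ga// sD// addrAC.
- move=> W f lW rf fU rtau; apply: regular_map_bundle => // w.
  have [V [sigma [h [Vx cV rh E]]]] := loc _ (fU w); have [oV _ _ _] := cV.
  have [oO rO] := rf V oV.
  exists ((@rho _ P \o f) @^-1` V), V, sigma; split=> //.
  apply: (regular_ext oO (f := fun w => tau (f w) - h (rho (f w)))).
    by move=> y Vy; rewrite E// addrK.
  apply: regularD => //; first exact: regular_sub (zopenT W) oO _ rtau.
  by apply: regular_onN => //; exact: rO.
Qed.

(** The difference of two fibre coordinates is invariant under the structure
    group; it is regular on the base because a section of the bundle pulls it
    back there. *)
Lemma chart_regular_diff U V tau sigma (g : B -> K) : chart U tau -> chart V sigma ->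
  (forall x, U (rho x) -> V (rho x) -> tau x = sigma x + g (rho x)) ->
  regular_on (U `&` V) g.
Proof.
move=> [oU rt tD lift] [oV rs sD _] E.
have oUV := zopenI oU oV; set A := U `&` V.
(* the section of the bundle over [A] on which the coordinate [tau] vanishes *)
have /choice[s sP] : forall a : induced_space A,
    exists x : P, rho x = sval a /\ tau x = 0.
  case=> u [Uu Vu] /=.
  have [x xu] := rho_surjective u; exists (ga (- tau x) x).
  by rewrite rho_ga tD ?xu// subrr.
have lA : locally_ringed (induced_space A) by exact/locally_ringed_induced/locally_ringed_base.
have rsv := @regular_map_sval _ B A.
have oT := zopenT (induced_space A).
have rS : regular_map s.
  apply: lift => //.
  - by apply: regular_map_ext rsv => a /=; have [] := sP a.
  - by move=> a; have [-> _] := sP a; case: a => ? [].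
  - by apply: regular_ext (regular_cst 0 oT) => // a _ /=; have [] := sP a.
have [_ rV] := rS _ (zopen_rho oV); have := rV _ rs.
have -> : s @^-1` (@rho _ P @^-1` V) = setT.
  by apply/seteqP; split=> // a _ /=; have [-> _] := sP a; case: a => ? [].
move=> /(regular_onN oT) r1; apply: (regular_on_of_induced oUV) => //.
have -> : (@sval B A) @^-1` A = setT by apply/seteqP; split=> // -[].
apply: regular_ext r1 => // a _ /=; have [ra ta] := sP a.
have [Ua Va] : U (sval a) /\ V (sval a) by case: (a) => ? [].
by move: (E (s a)); rewrite ra ta => /(_ Ua Va)/eqP; rewrite eq_sym addrC addr_eq0 => /eqP ->.
Qed.

Lemma chart_trivial tau : chart setT tau -> trivial_bundle P.
Proof.
move=> [oT rt tD lift]; exists tau; split; last by move=> t x _; exact: tD.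
set BxK := product_space (induced_space (@setT B)) (Ga K).
have /choice[s sP] : forall z : BxK,
    exists x : P, rho x = sval z.1 /\ tau x = z.2 0 0.
  case=> -[u Tu] t /=; have [x xu] := rho_surjective u.
  by exists (ga (t 0 0 - tau x) x); rewrite rho_ga tD// addrC subrK.
have lP := locally_ringed_bundle.
have rsv := @regular_map_sval _ P (@rho _ P @^-1` setT).
have lI : locally_ringed (induced_space (@rho _ P @^-1` setT)).
  exact: locally_ringed_induced.
have rs : regular_map s.
  apply: lift => //.
  - exact: locally_ringed_product.
  - apply: regular_map_ext (regular_map_comp (@regular_map_fst _ _ _)
      (@regular_map_sval _ _ _)) => z /=.
    by have [] := sP z.
  - have [_ /(_ _ (regular_on_coord 0 (zopenT (Ga K))))] :=
      @regular_map_snd _ (induced_space (@setT B)) (Ga K) _ (zopenT _).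
    by apply: regular_ext => [|z _ /=]; [exact: zopenT|have [] := sP z].
split.
  apply: regular_map_product => //.
    by apply: regular_map_induced; exact: (regular_map_comp rsv (@rho_regular _ P)).
  apply: regular_map_affine => // i.
  have [_ /(_ _ rt)] := rsv _ (zopenT P).
  by apply: regular_ext => [|z _ /=]; [exact: zopenT|rewrite mxE].
exists (fun z => exist (@rho _ P @^-1` setT) (s z) I); split.
- exact: regular_map_induced.
- move=> [x Tx] /=; apply: eq_exist => /=.
  set z := (X in s X); have [rz tz] := sP z.
  have [t xE] : exists t, x = ga t (s z) by apply: ga_transitive; rewrite rz.
  have := congr1 tau xE; rewrite tD// tz /z /= mxE => /eqP.
  by rewrite addrC -subr_eq subrr eq_sym => /eqP t0; rewrite [RHS]xE t0 ga0.
- move=> [[u Tu] t] /=; have [r1 r2] := sP (exist _ u Tu, t); congr pair.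
    exact: eq_exist.
  by apply/rowP => i; rewrite mxE r2 (ord1 i).
Qed.

End Charts.

(** * Vanishing of the first cohomology of a chart of the projective line *)
Section Slices.
Variable K : closedFieldType.
Notation B := (punctured_plane K).
Implicit Types (a b : 'I_2) (u v : B) (z : K).

Lemma slice_subproof a z : ((\row_(k < 2) (if k == a then 1 else z)) : 'rV[K]_2) != 0.
Proof.
by apply/eqP => /rowP/(_ a)/eqP; rewrite !mxE eqxx oner_eq0.
Qed.

(** The point over [z] of the affine chart of the projective line on which the
    coordinate of index [a] is inverted. *)
Definition slice a z : B := exist (fun v : 'rV[K]_2 => v != 0) _ (slice_subproof a z).

Definition slope a b u : K := sval u 0 b / sval u 0 a.

Lemma ord2_eq a b k : a != b -> k != a -> k = b.
Proof.
move: a b k => [a ia] [b ib] [k ik]; rewrite -!val_eqE /= => ab ka.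
by apply: val_inj => /=; lia.
Qed.

Lemma slice_scale a b u : a != b -> sval u 0 a != 0 ->
  sval u = sval u 0 a *: sval (slice a (slope a b u)).
Proof.
move=> ab ua; apply/rowP => k; rewrite !mxE; case: eqVneq => [->|ka].
  by rewrite mulr1.
by rewrite (ord2_eq ab ka) /slope mulrC divfK.
Qed.

Lemma slope_slice a b z : a != b -> slope a b (slice a z) = z.
Proof. by move=> ab; rewrite /slope !mxE eqxx eq_sym (negPf ab) divr1. Qed.

Lemma slice_coord a z : sval (slice a z) 0 a = 1.
Proof. by rewrite mxE eqxx. Qed.

Lemma Gm_stable_slice (U : set B) a b u : Gm_stable U -> a != b -> sval u 0 a != 0 ->
  U u <-> U (slice a (slope a b u)).
Proof.
move=> sU ab ua; have uE := slice_scale ab ua; split=> H; last exact: (sU _ _ _ ua uE H).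
apply: (sU (sval u 0 a)^-1 u) => //; first by rewrite invr_eq0.
by rewrite -[LHS]scale1r -(mulVf ua) -scalerA -uE.
Qed.

Lemma regular_coord (U : set B) i : zopen U -> regular_on U (fun u : B => sval u 0 i).
Proof.
move=> oU; have oT := zopenT (affine_space K 2).
have [_ /(_ _ (regular_on_coord i oT))] := 
  @regular_map_sval K (affine_space K 2) (fun v : 'rV[K]_2 => v != 0) _ oT.
by apply: regular_sub => //; exact: zopenT.
Qed.

Lemma regular_curve_slice a : regular_curve (slice a).
Proof.
have lA := @locally_ringed_affine K 1; have oT := zopenT (affine_space K 1).
apply/regular_map_induced/regular_map_affine => // i.
have [ia|ia] := eqVneq i a.
  by apply: regular_ext (regular_cst 1 oT) => // t _; rewrite mxE ia eqxx.
apply: regular_ext (regular_on_coord 0 oT) => // t _.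
by rewrite /= mxE (negPf ia).
Qed.

Definition coord_chart a : set B := [set u : B | sval u 0 a != 0].

Lemma zopen_coord_chart a : zopen (coord_chart a).
Proof.
rewrite -[X in zopen X]setTI; apply: zopen_neq0; first exact: locally_ringed_base.
  exact: zopenT.
exact/regular_coord/zopenT.
Qed.

Lemma homogeneous_slice (U : set B) g d a b u : Gm_stable U ->
  homogeneous_function d U g -> a != b -> sval u 0 a != 0 -> U u ->
  g u = sval u 0 a ^- d * g (slice a (slope a b u)).
Proof.
move=> sU [_ hg] ab ua Uu; apply: hg => //; first exact: slice_scale.
exact/(Gm_stable_slice sU ab ua).
Qed.

Lemma Gm_stableI (U V : set B) : Gm_stable U -> Gm_stable V -> Gm_stable (U `&` V).
Proof. by move=> sU sV l u v l0 E [Uu Vu]; split; [apply: sU E Uu|apply: sV E Vu]. Qed.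

End Slices.

Section Gluing.
Variables (K : closedFieldType) (P : Ga_bundle K) (d : nat).
Implicit Types (t : P -> K).

(** A bundle glued from two trivial pieces over the charts of the projective
    line, the difference of the fibre coordinates being homogeneous of degree
    [-d]: the Laurent polynomial is that of the section of [O(-d)]. *)
Definition laurent_glued t0 t1 N (p : {poly K}) : Prop :=
  [/\ chart (@coord_chart K 0) t0, chart (@coord_chart K 1) t1 &
      forall x : P, sval (rho x) 0 0 != 0 -> sval (rho x) 0 1 != 0 ->
        t0 x = t1 x + sval (rho x) 0 0 ^- d *
          (p.[slope 0 1 (rho x)] / slope 0 1 (rho x) ^+ N)].

Definition homogeneous_coord (act : K -> P -> P) a t : Prop :=
  forall l x, l != 0 -> sval (rho x) 0 a != 0 -> t (act l x) = l ^- d * t x.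

End Gluing.

Section Cover.
Variables (K : closedFieldType) (P : Ga_bundle K) (d : nat) (I : Type).
Notation B := (punctured_plane K).
Variables (U : I -> set B) (tau : I -> P -> K) (g : I -> I -> B -> K).
Hypothesis stab : forall i, Gm_stable (U i).
Hypothesis cover : forall u, exists i, U i u.
Hypothesis charts : forall i, chart (U i) (tau i).
Hypothesis hom : forall i j, homogeneous_function d (U i `&` U j) (g i j).
Hypothesis cocycle : forall i j x, (U i `&` U j) (rho x) ->
  tau i x = tau j x + g i j (rho x).

Let oU i : zopen (U i). Proof. by case: (charts i). Qed.

Section OneChart.
Variables (a b : 'I_2).
Hypothesis ab : a != b.

(** [t] is a fibre coordinate over the points of the chart whose slope is not
    in [bad]; it differs from each [tau i] by a homogeneous function, written
    as a function [h] of the slope. *)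
Let compatible (bad : seq K) (t : P -> K) : Prop :=
  forall i, exists h : K -> K,
    (forall z, z \notin bad -> U i (slice a z) -> regular_at h z) /\
    (forall x, sval (rho x) 0 a != 0 -> slope a b (rho x) \notin bad ->
       U i (rho x) -> t x = tau i x + sval (rho x) 0 a ^- d * h (slope a b (rho x))).

Let regular_cocycle i j z : U i (slice a z) -> U j (slice a z) ->
  regular_at (g i j \o slice a) z.
Proof.
move=> Ui Uj; apply: regular_at_curve (hom i j).1 _ => //.
  exact: regular_curve_slice.
exact: zopenI.
Qed.

Let rho_slice z : exists x : P, rho x = slice a z.
Proof. exact: rho_surjective. Qed.

Let compatible_start : exists bad t, compatible bad t.
Proof.
have [i0 Ui0] := cover (slice a 0).
have [r [r0 rU]] := regular_curve_open (@regular_curve_slice _ a) (oU i0) Ui0.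
have [bad badP] : exists bad : seq K, forall z, z \notin bad -> r.[z] != 0.
  have [bad rE] := closed_field_poly_normal r; exists bad => z.
  apply: contraNneq => /rootP; rewrite rE rootZ ?root_prod_XsubC//.
  by rewrite lead_coef_eq0 (poly_neq0_horner r0).
exists bad, (tau i0) => i; exists (g i0 i \o slice a); split=> [z /badP/rU Uz Ui|x xa xb Ui].
  exact: regular_cocycle.
have Ui0x : U i0 (rho x) by apply/(Gm_stable_slice (@stab i0) ab xa)/rU/badP.
rewrite (@cocycle i0 i)//; congr (_ + _).
by apply: homogeneous_slice (hom i0 i) ab xa _ => //; exact: Gm_stableI.
Qed.

(** One more point [z0] is added by removing from [t] its principal part at
    [z0] with respect to some [tau j]; since a principal part is regular
    everywhere else, nothing is lost at the other points. *)
Let compatible_step z0 bad t : compatible (z0 :: bad) t -> exists t', compatible bad t'.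
Proof.
move=> ct; have [z0bad|z0bad] := boolP (z0 \in bad).
  have notin z : z \notin bad -> z \notin z0 :: bad.
    by move=> zb; rewrite inE negb_or zb andbT; apply: contraNneq zb => ->.
  exists t => i; have [h [rh hE]] := ct i; exists h.
  by split=> [z /notin|x xa /notin]; [exact: rh|exact: hE].
have [j Uj] := cover (slice a z0); have [hj [rhj hjE]] := ct j.
have [rj [rj0 rjU]] := regular_curve_open (@regular_curve_slice _ a) (oU j) Uj.
set s := \prod_(c <- bad) ('X - c%:P).
have sE z : s.[z] != 0 -> z \notin bad.
  by apply: contra => zb; rewrite -[_ == 0]/(root s z) root_prod_XsubC.
have s0 : s.[z0] != 0 by rewrite -[_ == 0]/(root s z0) root_prod_XsubC.
have [z1 z1P] : exists z1, (rj * s * ('X - z0%:P)).[z1] != 0.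
  have /closed_nonrootP[z1] : rj * s * ('X - z0%:P) != 0.
    rewrite !mulf_neq0 ?polyXsubC_eq0 ?(poly_neq0_horner rj0) ?(poly_neq0_horner s0)//.
  by exists z1.
have [p [q [q1 hjpq]]] : regular_at hj z1.
  move: z1P; rewrite !hornerM hornerXsubC !mulf_eq0 !negb_or => /andP[/andP[r1 s1] z10].
  by apply: rhj; [rewrite inE negb_or -subr_eq0 z10 sE|exact: rjU].
have [e [q' /implyP/(_ (poly_neq0_horner q1)) q'0 qE]] := multiplicity_XsubC q z0.
have /Bezout_eq1_coprimepP[[c1 c2] /= c12] : coprimep q' (('X - z0%:P) ^+ e).
  by rewrite coprimep_expr// coprimep_XsubC.
set A := p * c1; set C := p * c2.
have pE : p = A * q' + C * ('X - z0%:P) ^+ e by rewrite -!mulrA -mulrDr c12 mulr1.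
have pq z : z != z0 -> q'.[z] != 0 ->
    hj z - A.[z] / (z - z0) ^+ e = C.[z] / q'.[z].
  move=> zz0 q'z; have ze : (z - z0) ^+ e != 0 by rewrite expf_neq0 ?subr_eq0.
  rewrite hjpq; last by rewrite qE hornerM horner_exp hornerXsubC mulf_neq0.
  rewrite pE qE hornerD !hornerM horner_exp hornerXsubC.
  by field; rewrite ze q'z.
have pp z : z != z0 -> regular_at (fun z => A.[z] / (z - z0) ^+ e) z.
  move=> zz0; apply: (regular_at_ext (r := 1) (f := fun z => A.[z] / (('X - z0%:P) ^+ e).[z])).
  - by rewrite hornerC oner_neq0.
  - by move=> t' _; rewrite horner_exp hornerXsubC.
  - by apply: regular_at_div; rewrite horner_exp hornerXsubC expf_neq0 ?subr_eq0.
pose t' x := let z := slope a b (rho x) in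
  if z == z0 then tau j x + sval (rho x) 0 a ^- d * (C.[z0] / q'.[z0])
  else t x - sval (rho x) 0 a ^- d * (A.[z] / (z - z0) ^+ e).
exists t' => i; have [hi [rhi hiE]] := ct i.
pose h' z := if z == z0 then C.[z0] / q'.[z0] + g j i (slice a z0)
  else hi z - A.[z] / (z - z0) ^+ e.
exists h'; split=> [z zbad Ui|x xa xbad Ui].
  have [zz0|zz0] := eqVneq z z0; last first.
    apply: (regular_at_ext (r := 'X - z0%:P) (f := fun z => hi z - A.[z] / (z - z0) ^+ e)).
    - by rewrite hornerXsubC subr_eq0.
    - by move=> y; rewrite hornerXsubC subr_eq0 /h' => /negPf ->.
    - apply: regular_atD; last exact/regular_atN/pp.
      by apply: rhi => //; rewrite inE negb_or zz0.
  rewrite zz0 in Ui *.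
  have [ri [ri0 riU]] := regular_curve_open (@regular_curve_slice _ a) (oU i) Ui.
  apply: (regular_at_ext (r := rj * ri * s * q')
    (f := fun z => C.[z] / q'.[z] + (g j i \o slice a) z)).
  - by rewrite !hornerM !mulf_neq0.
  - move=> y ry; have [rjy riy sy q'y] :
      [/\ rj.[y] != 0, ri.[y] != 0, s.[y] != 0 & q'.[y] != 0].
      by move: ry; rewrite !hornerM !mulf_eq0 !negb_or -!andbA => /and4P.
    rewrite /h'; case: eqVneq => [->//|yz0]; rewrite -pq//=.
    rewrite addrAC; congr (_ - _).
    have [x xy] := rho_slice y.
    have yb : y \notin z0 :: bad by rewrite inE negb_or yz0 sE.
    have xE := slope_slice y ab.
    have := hiE x; have := hjE x; rewrite xy slice_coord xE oner_neq0 expr1n invr1 !mul1r.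
    move=> /(_ isT yb (rjU _ rjy)) -> /(_ isT yb (riU _ riy)).
    rewrite (@cocycle j i) xy; last by split; [exact: rjU|exact: riU].
    by rewrite -addrA => /addrI; rewrite addrC.
  - by apply: regular_atD; [exact: regular_at_div|exact: regular_cocycle].
rewrite /t' /h' /=; case: eqVneq => [xz0|xz0].
  have Ujx : U j (rho x) by apply/(Gm_stable_slice (@stab j) ab xa); rewrite xz0.
  rewrite (@cocycle j i)// mulrDr -addrA; congr (_ + _); rewrite addrC; congr (_ + _).
  rewrite (homogeneous_slice _ (hom j i) ab xa) ?xz0//; exact: Gm_stableI.
rewrite hiE//; last by rewrite inE negb_or xz0.
by rewrite mulrBr addrA.
Qed.

(** The chart is an affine line times [Gm], on which every cocycle of degree
    [-d] is a coboundary; as the correction to each [tau i] is homogeneous, any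
    lift of the action for which the [tau i] have weight [-d] gives this weight
    to [t] as well. *)
Lemma chart_slices : exists t, [/\ chart (coord_chart a) t,
  forall i, exists h : K -> K,
    (forall z, U i (slice a z) -> regular_at h z) /\
    (forall x, sval (rho x) 0 a != 0 -> U i (rho x) ->
       t x = tau i x + sval (rho x) 0 a ^- d * h (slope a b (rho x))) &
  forall act : K -> P -> P,
    (forall l x, l != 0 -> sval (rho (act l x)) = l *: sval (rho x)) ->
    (forall i l x, l != 0 -> U i (rho x) -> tau i (act l x) = l ^- d * tau i x) ->
    forall l x, l != 0 -> sval (rho x) 0 a != 0 -> t (act l x) = l ^- d * t x].
Proof.
have [t ct] : exists t, compatible [::] t.
  have [bad [t ct]] := compatible_start.
  by elim: bad t ct => [|z0 bad IH] t; [exists t|case/compatible_step].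
exists t; split=> [|i|act actP tauP l x l0 xa].
- apply: chart_local => [|u ua]; first exact: zopen_coord_chart.
  have [i Ui] := cover u; have [h [rh hE]] := ct i.
  have oV := zopenI (oU i) (@zopen_coord_chart K a).
  have ra : regular_on (U i `&` coord_chart a) (fun u : B => sval u 0 a) by exact: regular_coord.
  have lB := @locally_ringed_base K.
  exists (U i `&` coord_chart a), (tau i),
    (fun u : B => sval u 0 a ^- d * (h \o slope a b) u); split=> //.
  + by apply: (chartS oV _ (charts i)) => ? [].
  + apply: regularM => //.
      apply: regular_onV => //; first exact: regular_onX.
      by move=> v [_ va]; rewrite expf_neq0.
    apply: regular_on_regular_at => //.
      by apply: regular_on_div => //; [exact: regular_coord|move=> v []].
    by move=> v [Uv va]; apply: rh => //; exact/(Gm_stable_slice (@stab i) ab va).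
  + by move=> x xa [Ux _]; rewrite hE.
- by have [h [rh hE]] := ct i; exists h; split=> [z|x xa]; [exact: rh|exact: hE].
- have [i Ui] := cover (rho x); have [h [_ hE]] := ct i; have rE := actP l x l0.
  rewrite (hE (act l x))//; last 2 first.
  + by rewrite rE mxE mulf_neq0.
  + exact: (stab l0 rE).
  rewrite tauP// hE// mulrDr; congr (_ + _).
  by rewrite /slope rE !mxE -mulf_div divff// mul1r exprMn invfM mulrA.
Qed.

End OneChart.

(** On the intersection of the two charts a homogeneous function is determined
    by its values at the points with first coordinate [1]; these values form a
    function of the slope that is regular wherever the slope is not zero, hence
    a Laurent polynomial. *)
Lemma laurent_cocycle M : exists t0 t1 N p, [/\ (M <= N)%N,
  laurent_glued d t0 t1 N p &
  forall act : K -> P -> P,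
    (forall l x, l != 0 -> sval (rho (act l x)) = l *: sval (rho x)) ->
    (forall i l x, l != 0 -> U i (rho x) -> tau i (act l x) = l ^- d * tau i x) ->
    homogeneous_coord d act 0 t0 /\ homogeneous_coord d act 1 t1].
Proof.
have n01 : (0 : 'I_2) != 1 by []; have n10 : (1 : 'I_2) != 0 by [].
have [t0 [c0 hE0 act0]] := chart_slices n01.
have [t1 [c1 hE1 act1]] := chart_slices n10.
have /choice[s sP] : forall z : K, exists x : P, rho x = slice 0 z.
  by move=> z; exact: rho_surjective.
pose G z := t0 (s z) - t1 (s z).
have slopeV (u : B) : slope 1 0 u = (slope 0 1 u)^-1 by rewrite /slope invf_div.
have diff i : exists h k : K -> K,
    [/\ forall z, U i (slice 0 z) -> regular_at h z,
        forall z, U i (slice 1 z) -> regular_at k z &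
        forall x, sval (rho x) 0 0 != 0 -> sval (rho x) 0 1 != 0 -> U i (rho x) ->
        t0 x - t1 x = sval (rho x) 0 0 ^- d * (h (slope 0 1 (rho x)) -
          (slope 0 1 (rho x))^-1 ^+ d * k (slope 0 1 (rho x))^-1)].
  have [[h [rh hE]] [k [rk kE]]] := (hE0 i, hE1 i).
  exists h, k; split=> // x x0 x1 Ui; rewrite hE// kE// -slopeV.
  rewrite opprD addrACA subrr add0r mulrBr mulrA; congr (_ - _ * _).
  by rewrite /slope expr_div_n mulrA mulVf ?expf_neq0// mul1r.
have rG z : z != 0 -> regular_at G z.
  move=> z0; have [i Ui] := cover (slice 0 z).
  have [r [r0 rU]] := regular_curve_open (@regular_curve_slice _ 0) (oU i) Ui.
  have [h [k [rh rk hkE]]] := diff i.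
  apply: (regular_at_ext (r := r * 'X)
    (f := fun y => h y + - (y^-1 ^+ d * k y^-1))).
  - by rewrite hornerM hornerX mulf_neq0.
  - move=> y; rewrite hornerM hornerX mulf_eq0 negb_or => /andP[ry y0].
    have := hkE (s y); rewrite sP slope_slice// slice_coord oner_neq0 expr1n invr1 mul1r.
    by rewrite mxE /= => /(_ isT y0 (rU _ ry)) <-.
  - apply: regular_atD; first exact: rh.
    apply/regular_atN/(regular_at_inv (f := fun y => y ^+ d * k y)) => //.
    apply: regular_atM.
      apply: (regular_at_ext (r := 1) (f := horner 'X^d)); last exact: regular_at_horner.
        by rewrite hornerC oner_neq0.
      by move=> y _; rewrite hornerXn.
    apply: rk; rewrite -[X in X^-1](slope_slice z n01) -slopeV.
    have z1 : sval (slice 0 z) 0 1 != 0 by rewrite mxE.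
    exact: (Gm_stable_slice (@stab i) n10 z1).1 Ui.
have [N [p [MN pE]]] := regular_laurent M rG.
exists t0, t1, N, p; split=> // [|act actP tauP]; last first.
  by split=> l x l0 xa; [exact: act0|exact: act1].
split=> // x x0 x1; set z := slope 0 1 (rho x).
have z0 : z != 0 by rewrite mulf_neq0 ?invr_eq0.
have [i Ui] := cover (rho x); have [h [k [_ _ hkE]]] := diff i.
apply/eqP; rewrite addrC -subr_eq; apply/eqP; rewrite hkE// -/z -pE//; congr (_ * _).
have Uz : U i (slice 0 z) by apply/(Gm_stable_slice (@stab i) n01 x0).
have := hkE (s z); rewrite sP slope_slice// slice_coord oner_neq0 expr1n invr1 mul1r.
by rewrite mxE /= => /(_ isT z0 Uz) <-.
Qed.

End Cover.

(** The difference of two equivariant fibre coordinates descends to the base,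
    and keeps there the weight that both have for the lifted action; thus a
    homogeneous lift provides its own homogeneous cocycle. *)
Lemma homogeneous_lift_cover (K : closedFieldType) (P : Ga_bundle K) d (s : Gm_lift P) :
  homogeneous_lift d s ->
  exists (I : Type) (U : I -> set (punctured_plane K)) (tau : I -> P -> K)
    (g : I -> I -> punctured_plane K -> K),
  [/\ forall i, Gm_stable (U i) /\ chart (U i) (tau i), forall u, exists i, U i u,
      forall i j, homogeneous_function d (U i `&` U j) (g i j),
      forall i j x, (U i `&` U j) (rho x) -> tau i x = tau j x + g i j (rho x) &
      forall i l x, l != 0 -> U i (rho x) -> tau i (s l x) = l ^- d * tau i x].
Proof.
move=> [I [U [tau [oU cov triv hom]]]].
have ch i : chart (U i) (tau i) by apply: trivialization_chart => //; case: (oU i).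
have /choice[r rP] : forall u, exists x : P, rho x = u by exact: rho_surjective.
pose g i j u := tau i (r u) - tau j (r u).
have gE i j x : U i (rho x) -> U j (rho x) -> tau i x = tau j x + g i j (rho x).
  move=> Ui Uj; have [t xt] := ga_transitive (rP (rho x)).
  have [[_ _ Di _] [_ _ Dj _]] := (ch i, ch j).
  by rewrite {1 2}xt Di ?Dj ?rP// /g; ring.
have stab i : Gm_stable (U i) by case: (oU i).
exists I, U, tau, g; split=> // [i j|i j x []]; last exact: gE.
split; first exact: chart_regular_diff (ch i) (ch j) (@gE i j).
move=> l u v l0 uv [Ui Uj].
have vE : rho (s l (r u)) = v.
  by apply: eq_sig_hprop => [w|]; [exact: bool_irrelevance|rewrite rho_Gm_act// rP].
have [Vi Vj] : U i v /\ U j v by split; [apply: stab uv Ui|apply: stab uv Uj].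
have := @gE i j (s l (r u)); rewrite vE => /(_ Vi Vj).
rewrite !hom ?rP// => E; apply: (@addrI _ (l ^- d * tau j (r u))).
by rewrite -E -mulrDr addrC subrK.
Qed.

(** * Choosing the second coordinate *)
Section Direction.
Variables (K : closedFieldType) (P : Ga_bundle K).
Hypothesis char0 : [pchar K] =i pred0.
Variables (m N : nat) (t0 t1 : P -> K) (p : {poly K}).
Hypothesis mN : (m.+2 <= N)%N.
Hypothesis glued : laurent_glued m.+2 t0 t1 N p.

Lemma coef_XsubC_exp s :
  (('X - s%:P) ^+ m * p)`_N.-1 =
  (\poly_(j < m.+1) ((-1) ^+ j * 'C(m, j)%:R * p`_(N.-1 - (m - j)))).[s].
Proof.
rewrite horner_poly exprBn mulr_suml coef_sum.
apply: eq_bigr => j _; have jm : (j <= m)%N by rewrite -ltnS.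
transitivity (((((-1) ^+ j * s ^+ j * 'C(m, j)%:R)%:P * ('X^(m - j) * p))`_N.-1)).
  congr (polyseq _)`_ _; rewrite !polyCM !polyC_exp polyCN polyC1 polyC_natr -mulr_natr.
  ring.
rewrite coefCM coefXnM ltnNge (_ : (m - j <= N.-1)%N) /=; last by lia.
ring.
Qed.

(** The coefficient [N - 1] of [(X - s)^m p] is, up to a factor, the value of
    Serre duality at the class of the bundle and the form [(y - s x)^m].  If it
    vanishes for all [s] then so does the class, because the powers of linear
    forms span all forms in characteristic zero. *)
Lemma generic_direction : ~ trivial_bundle P ->
  exists s, (('X - s%:P) ^+ m * p)`_N.-1 != 0.
Proof.
move=> ntriv; apply: contrapT => all0; apply: ntriv.
set Q := \poly_(j < m.+1) ((-1) ^+ j * 'C(m, j)%:R * p`_(N.-1 - (m - j))).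
have Q0 : Q = 0.
  apply: (poly_eq0_on_open (q := 1)) => [|s _]; first exact: oner_neq0.
  rewrite -coef_XsubC_exp; apply/eqP/negPn/negP => H.
  by apply: all0; exists s.
have p0 i : (i <= m)%N -> p`_(N.-1 - i) = 0.
  move=> im; have := congr1 (fun q : {poly K} => q`_(m - i)) Q0.
  rewrite coef_poly coef0 subKn// ltnS leq_subr => /eqP.
  rewrite !mulf_eq0 signr_eq0 /= => /orP[|/eqP//].
  by rewrite ((pcharf0P _).1 char0) -leqn0 leqNgt bin_gt0 leq_subr.
set L := (N - m.+1)%N; set C := drop_poly N p; set A := take_poly L p.
have pE z : z != 0 -> p.[z] / z ^+ N = A.[z] / z ^+ N + C.[z].
  move=> z0; have -> : p = A + C * 'X^N.
    rewrite -{1}[p](poly_take_drop N) addrC [RHS]addrC; congr (_ + _).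
    apply/polyP => i; rewrite !coef_take_poly.
    case: ltnP => iN; case: ltnP => iL //; last by lia.
    by have := p0 (N.-1 - i)%N; rewrite subKn; [apply|]; lia.
  by rewrite hornerD hornerM hornerXn mulrDl mulfK ?expf_neq0.
have [ch0 ch1 gE] := glued.
have lB := @locally_ringed_base K.
have oC a := @zopen_coord_chart K a.
have rc a i : regular_on (@coord_chart K a) (fun u : punctured_plane K => sval u 0 i).
  exact: regular_coord.
pose h (u : punctured_plane K) := sval u 0 0 ^- m.+2 * C.[slope 0 1 u].
pose k (u : punctured_plane K) :=
  \sum_(i < L) A`_i * sval u 0 0 ^+ (N - i - m.+2) * sval u 0 1 ^- (N - i).
have rh : regular_on (@coord_chart K 0) h.
  apply: regularM => //.
    apply: regular_onV => //; first exact: regular_onX.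
    by move=> u u0; rewrite expf_neq0.
  by apply: regular_on_horner => //; exact: regular_on_div.
have rk : regular_on (@coord_chart K 1) k.
  apply: regular_on_sum => // i; apply: regularM => //.
    by apply: regularM => //; [exact: regular_cst|exact: regular_onX].
  apply: regular_onV => //; first exact: regular_onX.
  by move=> u u0; rewrite expf_neq0.
pose t x := if sval (rho x) 0 0 != 0 then t0 x - h (rho x) else t1 x + k (rho x).
have tE x : sval (rho x) 0 1 != 0 -> t x = t1 x + k (rho x).
  rewrite /t; case: ifP => // x0 x1; rewrite gE//.
  set z := slope 0 1 (rho x); have z0 : z != 0 by rewrite mulf_neq0 ?invr_eq0.
  rewrite pE// /h mulrDr addrA addrK; congr (_ + _).
  rewrite (horner_coef_wide _ (size_take_poly _ _)) mulr_suml mulr_sumr.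
  apply: eq_bigr => i _; rewrite -!mulrA mulrCA; congr (_ * _).
  have iL : (i < N - m.+1)%N := ltn_ord i.
  set e := (N - i - m.+2)%N; have Ni : (N - i = e + m.+2)%N by lia.
  rewrite Ni (_ : N = e + m.+2 + i)%N; last by lia.
  rewrite /z /slope; move: (e) => f.
  by rewrite !expr_div_n !exprD; field; rewrite !expf_neq0.
apply: (@chart_trivial _ _ t); apply: chart_local => [|u _]; first exact: zopenT.
have [u0|u0] := eqVneq (sval u 0 0) 0.
  exists (@coord_chart K 1), t1, k; split=> //; last by move=> x _ /tE.
  apply: contraNneq (svalP u) => u1; apply/eqP/rowP => i; rewrite mxE.
  by have [->//|i0] := eqVneq i 0; rewrite (ord2_eq (a := 0) (b := 1) _ i0).
exists (@coord_chart K 0), t0, (fun u => - h u); split=> //; first exact: regular_onN.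
by move=> x _ x0; rewrite /t; case: ifP => //; rewrite x0.
Qed.

End Direction.

(** * The model hypersurfaces *)
Notation ix := (@Ordinal 4 0 isT).
Notation iy := (@Ordinal 4 1 isT).
Notation iv := (@Ordinal 4 2 isT).
Notation iu := (@Ordinal 4 3 isT).

Section Hypersurface.
Variable K : closedFieldType.

Definition row4 (a b c d : K) : 'rV[K]_4 := \row_i [:: a; b; c; d]`_i.

Definition on_hypersurface n (z : 'rV[K]_4) : Prop :=
  z 0 ix * z 0 iv - z 0 iy ^+ n * z 0 iu = 1.

(** The total space of the bundle whose class is that of [x^-1 y^-n]. *)
Definition hypersurface n : space K :=
  induced_space (on_hypersurface n : set (affine_space K 4)).

(** The scalar [l] of [Gm] multiplies the coordinates [x], [y], [v], [u] by these
    factors; the equation of the hypersurface is then invariant. *)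
Definition weights n (l : K) : 'rV[K]_4 := row4 l l l^-1 (l ^- n).

Lemma row4_ext (a b : 'rV[K]_4) : a 0 ix = b 0 ix -> a 0 iy = b 0 iy ->
  a 0 iv = b 0 iv -> a 0 iu = b 0 iu -> a = b.
Proof.
move=> e0 e1 e2 e3; apply/rowP => -[[|[|[|[|//]]]] i4];
  by rewrite (bool_irrelevance i4 isT).
Qed.

Lemma locally_ringed_hypersurface n : locally_ringed (hypersurface n).
Proof. exact/locally_ringed_induced/locally_ringed_affine. Qed.

Lemma regular_hypersurface_coord n (U : set (hypersurface n)) i : zopen U ->
  regular_on U (fun z : hypersurface n => sval z 0 i).
Proof.
move=> oU; have oT := zopenT (affine_space K 4).
have [_ /(_ _ (regular_on_coord i oT))] :=
  @regular_map_sval K (affine_space K 4) (on_hypersurface n) _ oT.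
by apply: regular_sub => //; exact: zopenT.
Qed.

Lemma hypersurface_is_affine n : is_affine (hypersurface n).
Proof.
exists 4, (on_hypersurface n); split; last first.
  by exists id; split; [|exists id; split].
exists [set 'X_ix * 'X_iv - 'X_iy ^+ n * 'X_iu - 1].
have E z : peval ('X_ix * 'X_iv - 'X_iy ^+ n * 'X_iu - 1) z =
    z 0 ix * z 0 iv - z 0 iy ^+ n * z 0 iu - 1.
  by rewrite /peval !mevalB !mevalM meval1 rmorphXn /= !mevalXU.
apply/seteqP; split=> z /=.
  by move=> nz; eexists; [reflexivity|]; rewrite E subr_eq0; apply/eqP.
by move=> [_ -> ]; rewrite E subr_eq0 => /eqP.
Qed.

End Hypersurface.

Section Series.
Variable K : closedFieldType.
Implicit Types (p F : {poly K}).

(** To any order [n], a power series is a series in [X psi] when [psi] is a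
    unit: the coefficients are found one at a time. *)
Lemma poly_inversion F (psi : {poly K}) n : psi.[0] != 0 ->
  exists E R, forall w, F.[w] = E.[w * psi.[w]] + w ^+ n * R.[w].
Proof.
move=> psi0; elim: n => [|n [E [R ER]]].
  by exists 0, F => w; rewrite horner0 add0r mul1r.
set e := R.[0] / psi.[0] ^+ n.
have /factor_theorem[R' R'E] : root (R - e *: psi ^+ n) 0.
  by rewrite /root hornerD hornerN hornerZ horner_exp divfK ?expf_neq0// subrr.
exists (E + e *: 'X^n), R' => w; have := congr1 (fun q : {poly K} => q.[w]) R'E.
rewrite hornerD hornerN hornerZ horner_exp hornerM hornerXsubC subr0.
move=> /eqP; rewrite subr_eq => /eqP RE.
rewrite ER RE hornerD hornerZ hornerXn exprMn exprS; ring.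
Qed.

Definition taylor_quotient p (a h : K) : K :=
  \sum_(i < size p) p^`N(i.+1).[a] * h ^+ i.

Lemma taylor_quotientP p a h : p.[a + h] = p.[a] + h * taylor_quotient p a h.
Proof.
rewrite (nderiv_taylor_wide (n := (size p).+1)) ?leqnSn//; last exact: mulrC.
rewrite big_ord_recl nderivn0 expr0 mulr1; congr (_ + _).
by rewrite /taylor_quotient mulr_sumr; apply: eq_bigr => i _; rewrite exprS mulrCA.
Qed.

Lemma regular_on_taylor_quotient (X : space K) (U : set X) p (a h : X -> K) :
  zopen U -> regular_on U a -> regular_on U h ->
  regular_on U (fun x => taylor_quotient p (a x) (h x)).
Proof.
move=> oU ra rh; apply: regular_on_sum => // i.
by apply: regularM => //; [exact: regular_on_horner|exact: regular_onX].
Qed.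

End Series.

(** * Every nontrivial homogeneous bundle is a model hypersurface *)
Section Model.
Variables (K : closedFieldType) (P : Ga_bundle K).
Notation B := (punctured_plane K).
Variables (m N : nat) (t0 t1 : P -> K) (p : {poly K}) (s : K).
Hypothesis mN : (m.+2 <= N)%N.
Hypothesis glued : laurent_glued m.+2 t0 t1 N p.
Hypothesis generic : (('X - s%:P) ^+ m * p)`_N.-1 != 0.

Let n := m.+1.
Let px (q : P) : K := sval (rho q) 0 0.
Let py (q : P) : K := sval (rho q) 0 1.
Let pl (q : P) : K := py q - s * px q.
Let pw (q : P) : K := pl q / px q.

Let ch0 : chart (@coord_chart K 0) t0. Proof. by case: glued. Qed.
Let ch1 : chart (@coord_chart K 1) t1. Proof. by case: glued. Qed.

Let Q := ('X - s%:P) ^+ n * p.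
Let A := drop_poly N Q \Po ('X + s%:P).

(** A function of weight [-1]: since [H^1] of the punctured plane
    vanishes in degree [-1], the form [l^n] of degree [d - 1] kills the class
    of the bundle, and [l^n t] extends to the whole of [P] once corrected on
    each chart by the polar part of the Laurent polynomial lying there. *)
Let V (q : P) : K :=
  if px q != 0 then pl q ^+ n * t0 q - (px q)^-1 * A.[pw q]
  else pl q ^+ n * t1 q + \sum_(i < N) Q`_i * px q ^+ (N - i.+1) * py q ^- (N - i).

Let px_py q : px q = 0 -> py q != 0.
Proof.
move=> x0; apply: contraNneq (svalP (rho q)) => y0; apply/eqP/rowP => i.
rewrite mxE; have [->|i0] := eqVneq i 0; first exact: x0.
by rewrite (ord2_eq (a := 0) (b := 1) _ i0).
Qed.

Let pyE q : py q = pl q + s * px q. Proof. by rewrite subrK. Qed.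

Let pl_px q : pl q = 0 -> px q != 0.
Proof.
move=> l0; apply/eqP => x0; move: (px_py x0).
by rewrite pyE l0 x0 mulr0 addr0 eqxx.
Qed.

Let pl_pw q : px q != 0 -> pl q = px q * pw q.
Proof. by move=> x0; rewrite mulrC divfK. Qed.

Let slope_pw q : px q != 0 -> slope 0 1 (rho q) = pw q + s.
Proof. by move=> x0; rewrite /pw /pl mulrBl mulfK// subrK. Qed.

Let A_slope q : px q != 0 -> A.[pw q] = (drop_poly N Q).[slope 0 1 (rho q)].
Proof. by move=> x0; rewrite horner_comp hornerD hornerX hornerC slope_pw. Qed.

Let A0 : A.[0] != 0.
Proof.
have -> : A.[0] = (('X - s%:P) ^+ m * p)`_N.-1; last by [].
rewrite horner_comp hornerD hornerX hornerC add0r /Q exprS -mulrA.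
set r := _ * p; have -> : drop_poly N (('X - s%:P) * r) =
    (r`_N.-1)%:P + ('X - s%:P) * drop_poly N r.
  apply/polyP => i; rewrite coef_drop_poly mulrBl coefB coefXM coefCM.
  rewrite coefD coefC mulrBl coefB coefXM coefCM !coef_drop_poly.
  case: i => [|i] /=; first by rewrite add0n ifN ?(gtn_eqF, add0r)//; lia.
  by rewrite add0r addSn.
by rewrite hornerD hornerC hornerM hornerXsubC subrr mul0r addr0.
Qed.

Let V0 q : px q != 0 -> V q = pl q ^+ n * t0 q - (px q)^-1 * A.[pw q].
Proof. by rewrite /V => ->. Qed.

Let V1 q : py q != 0 ->
  V q = pl q ^+ n * t1 q + \sum_(i < N) Q`_i * px q ^+ (N - i.+1) * py q ^- (N - i).
Proof.
rewrite /V; case: ifP => // x0 y0.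
have [_ _ /(_ q x0 y0)] := glued; rewrite -/(px q).
set z := slope 0 1 (rho q) => tE; have z0 : z != 0 by rewrite mulf_neq0 ?invr_eq0.
rewrite tE A_slope// -/z mulrDr -addrA; congr (_ + _).
have plz : pl q = px q * (z - s) by rewrite /z slope_pw// addrK -pl_pw.
have -> : pl q ^+ n * (px q ^- m.+2 * (p.[z] / z ^+ N)) = (px q)^-1 * (Q.[z] / z ^+ N).
  rewrite plz hornerM horner_exp hornerXsubC exprMn exprS /n.
  by field; rewrite x0 !expf_neq0.
have -> : Q.[z] = (take_poly N Q).[z] + (drop_poly N Q).[z] * z ^+ N.
  by rewrite -{1}[Q](poly_take_drop N) hornerD hornerM hornerXn.
rewrite [X in _ * X]mulrDl mulfK ?expf_neq0// mulrDr addrK.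
rewrite (horner_coef_wide _ (size_take_poly _ _)) mulr_suml mulr_sumr.
apply: eq_bigr => -[i /= iN] _; rewrite coef_take_poly iN -!mulrA mulrCA; congr (_ * _).
set e := (N - i.+1)%N; have Ni : (N - i = e.+1)%N by lia.
rewrite Ni (_ : N = e + i.+1)%N; last by lia.
rewrite /z /slope -/(px q) -/(py q); move: (e) => f.
by rewrite !expr_div_n !exprD !exprS; field; rewrite x0 y0 !expf_neq0.
Qed.

Let V_ga t q : V (ga t q) = V q + pl q ^+ n * t.
Proof.
have [[_ _ D0 _] [_ _ D1 _]] := (ch0, ch1).
rewrite /V /pw /pl /px /py rho_ga; case: ifP => [x0|/negbFE/eqP x0].
  by rewrite D0//; ring.
by rewrite D1 ?mulrDr ?addrA 1?addrAC//; exact: px_py x0.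
Qed.

(** Modulo [l^n] the function [l V] is the series [- w A] in the slope [w], whose
    linear coefficient is not zero; the inverse series expresses [x V], which is
    [- A] to the same order, in terms of [l V]. *)
Lemma polar_part_inversion :
  exists E R : {poly K}, forall w, (- A).[w] = E.[w * (- A).[w]] + w ^+ n * R.[w].
Proof. by apply: poly_inversion; rewrite hornerN oppr_eq0. Qed.

Variables (E R : {poly K}).
Hypothesis ER : forall w, (- A).[w] = E.[w * (- A).[w]] + w ^+ n * R.[w].

Let E0 := E.[0].
Let E1 := drop_poly 1 E.

Let EE z : E.[z] = E0 + z * E1.[z].
Proof.
rewrite /E0 -{1 2}[E](poly_take_drop 1) -/E1 !hornerD !hornerM !hornerXn !expr1.
rewrite mulr0 addr0 mulrC; congr (_ + _).
by rewrite !(horner_coef_wide _ (size_take_poly 1 E)) !big_ord1 !expr0.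
Qed.

Let E0A : E0 = - A.[0].
Proof. by have := ER 0; rewrite mul0r exprS !mul0r addr0 hornerN => ->. Qed.

Let E0n : E0 != 0. Proof. by rewrite E0A oppr_eq0. Qed.

Let pT (q : P) : K := px q ^+ m.+2 * t0 q.
Let Phi w : K := w * (- A).[w].

(** On [l = 0] the quotient defining [U] still makes sense, the series [E]
    having been chosen so that its numerator is divisible by [l^n]. *)
Let U (q : P) : K :=
  if pl q != 0 then (px q * V q - E.[pl q * V q]) / (E0 * pl q ^+ n)
  else px q ^- n * (pT q + R.[0]) / E0.

Let xV q : px q != 0 -> px q * V q = pw q ^+ n * pT q - A.[pw q].
Proof.
move=> x0; rewrite V0// [in LHS]pl_pw// /pT exprMn [px q ^+ m.+2]exprS -/n.
by field.
Qed.

Let lV q : px q != 0 -> pl q * V q = Phi (pw q) + pw q ^+ n.+1 * pT q.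
Proof.
move=> x0; rewrite pl_pw// mulrAC xV// /Phi hornerN exprS; ring.
Qed.

Let U0 q : px q != 0 -> U q = px q ^- n * (pT q + R.[pw q] -
  pw q * pT q * taylor_quotient E (Phi (pw q)) (pw q ^+ n.+1 * pT q)) / E0.
Proof.
move=> x0; rewrite /U; case: ifP => [l0|/negbFE/eqP l0]; last first.
  by have -> : pw q = 0; [rewrite /pw l0 mul0r|rewrite !mul0r subr0].
have w0 : pw q != 0 by rewrite mulf_neq0 ?invr_eq0.
rewrite lV// xV// taylor_quotientP -/(Phi _) pl_pw// [(_ * _) ^+ _]exprMn.
have -> : E.[Phi (pw q)] = - A.[pw q] - pw q ^+ n * R.[pw q].
  by rewrite -hornerN ER -/(Phi _) addrK.
by rewrite [_ ^+ n.+1]exprS; field; rewrite E0n !expf_neq0.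
Qed.

(** The coefficients of [E] of positive index contribute to [x V - E (l V)] a
    multiple of [V], so that they can be absorbed in [x]; what remains is the
    equation of the model. *)
Let px' (q : P) : K := px q - pl q * E1.[pl q * V q].

Let F_subproof q : on_hypersurface n (row4 (px' q) (pl q) (V q / E0) (U q)).
Proof.
rewrite /on_hypersurface !mxE /=.
have [l0|l0] := eqVneq (pl q) 0.
  have x0 : px q != 0 by exact: pl_px.
  have w0 : pw q = 0 by rewrite /pw l0 mul0r.
  rewrite /px' l0 mul0r subr0 expr0n /= mul0r subr0 mulrA xV// w0 expr0n mul0r sub0r.
  by rewrite -E0A divff.
rewrite /U l0 EE /px'; field; rewrite E0n expf_neq0//.
Qed.

Let F (q : P) : hypersurface K n := exist (@on_hypersurface K n) _ (F_subproof q).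

Let U_ga t q : pl q = 0 -> U (ga t q) = U q + px q * t / E0.
Proof.
move=> l0; have x0 : px q != 0 by exact: pl_px.
have [_ _ D0 _] := ch0; have l0' : pl (ga t q) = 0 by rewrite /pl /py /px rho_ga.
rewrite /U l0 l0' eqxx /= /pT /px rho_ga D0// -/(px q) /n [_ ^+ m.+2]exprS.
by field; rewrite E0n expf_neq0.
Qed.

Let F_inj : injective F.
Proof.
move=> q q' /(congr1 (@sval _ _)) /= /rowP FE.
have := (FE ix, FE iy, FE iv, FE iu); rewrite !mxE /= => -[[[Ex El] Ev] Eu].
have EV : V q = V q' by move/(mulIf (invr_neq0 E0n)): Ev.
have {}Ex : px q = px q' by move: Ex; rewrite /px' El EV => /addIr.
have Er : rho q = rho q'.
  apply: eq_sig_hprop => [w|]; first exact: bool_irrelevance.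
  apply/rowP => i; have [->|i0] := eqVneq i 0; first exact: Ex.
  by rewrite (ord2_eq (a := 0) (b := 1) _ i0)// -/(py q) -/(py q') !pyE El Ex.
have [t qE] := ga_transitive Er; suff t0' : t = 0 by rewrite qE t0' ga0.
have [l0|l0] := eqVneq (pl q) 0.
  have x0 : px q != 0 by exact: pl_px.
  move: Eu; rewrite qE U_ga// => /eqP; rewrite addrC -subr_eq subrr eq_sym.
  by rewrite !mulf_eq0 (negPf x0) invr_eq0 (negPf E0n) orbF => /eqP.
move: EV; rewrite qE V_ga => /eqP; rewrite addrC -subr_eq subrr eq_sym.
by rewrite mulf_eq0 expf_eq0 (negPf l0) andbF => /eqP.
Qed.

(* the coordinates of the base point, found by inverting the definition of
   [px'] with [l] and [V] read off the hypersurface *)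
Let base_x (z : hypersurface K n) : K :=
  sval z 0 ix + sval z 0 iy * E1.[sval z 0 iy * (E0 * sval z 0 iv)].
Let base_y (z : hypersurface K n) : K := sval z 0 iy + s * base_x z.

Let base_neq0 z : (\row_(i < 2) (if i == 0 then base_x z else base_y z) : 'rV[K]_2) != 0.
Proof.
apply/eqP => /rowP b0; have := (b0 0, b0 1); rewrite !mxE /= => -[x0].
rewrite /base_y x0 mulr0 addr0 => y0; have := svalP z.
move: x0; rewrite /base_x /on_hypersurface y0 mul0r addr0 => ->.
by rewrite mul0r exprS mul0r mul0r subrr => /esym/eqP; rewrite oner_eq0.
Qed.

Let F_surj z : exists q, F q = z.
Proof.
pose b : B := exist (fun v : 'rV[K]_2 => v != 0) _ (base_neq0 z).
have [q0 q0b] := @rho_surjective K P b.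
have Ex t : px (ga t q0) = base_x z by rewrite /px rho_ga q0b /= mxE.
have El t : pl (ga t q0) = sval z 0 iy.
  by rewrite /pl Ex /py rho_ga q0b /= mxE /= /base_y addrK.
have zP : on_hypersurface n (sval z) := svalP z.
suff [t [tV tU]] : exists t, V (ga t q0) = E0 * sval z 0 iv /\ U (ga t q0) = sval z 0 iu.
  exists (ga t q0); apply: eq_sig_hprop => [w|]; first exact: Prop_irrelevance.
  apply: row4_ext; rewrite /= mxE //=.
  - by rewrite /px' Ex El tV /base_x addrK.
  - by rewrite tV mulrC mulKf.
have [l0|l0] := eqVneq (pl q0) 0.
  have y0 : sval z 0 iy = 0 by rewrite -(El 0) ga0.
  have x0 : px q0 != 0 by exact: pl_px.
  exists ((sval z 0 iu - U q0) * E0 / px q0); rewrite U_ga//; split; last first.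
    by field; rewrite E0n x0.
  set q := ga _ _; have Exq : px q = px q0 by rewrite /px rho_ga.
  have w0 : pw q = 0 by rewrite /pw /q El y0 mul0r.
  apply: (mulfI x0); rewrite -Exq xV ?Exq// w0 expr0n mul0r sub0r -E0A.
  move: zP; rewrite /on_hypersurface y0 expr0n mul0r subr0 => zP.
  by rewrite mulrCA -[px q0](congr1 px (ga0 q0)) Ex /base_x y0 mul0r addr0 zP mulr1.
exists ((E0 * sval z 0 iv - V q0) / pl q0 ^+ n).
have tV : V (ga ((E0 * sval z 0 iv - V q0) / pl q0 ^+ n) q0) = E0 * sval z 0 iv.
  by rewrite V_ga mulrC divfK ?expf_neq0// addrC subrK.
have l0' : sval z 0 iy != 0 by rewrite -(El 0) ga0.
split=> //; rewrite /U El l0' tV Ex EE /base_x; move: zP; rewrite /on_hypersurface.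
move=> /eqP; rewrite subr_eq => /eqP zP.
rewrite (_ : _ - _ = E0 * (sval z 0 ix * sval z 0 iv - 1)); last by ring.
by rewrite zP; field; rewrite E0n expf_neq0.
Qed.

Let lP : locally_ringed P := @locally_ringed_bundle K P.

Let regular_base i (W : set P) : zopen W -> regular_on W (fun q : P => sval (rho q) 0 i).
Proof.
move=> oW; have oB := zopenT B.
have [oT /(_ _ (regular_coord i oB))] := rho_regular P oB.
by apply: regular_sub => //; exact: zopenT.
Qed.

Let regular_pl (W : set P) : zopen W -> regular_on W pl.
Proof.
move=> oW; apply: regular_onB => //; first exact: regular_base.
by apply: regularM => //; [exact: regular_cst|exact: regular_base].
Qed.

Let over a : set P := @rho _ P @^-1` (@coord_chart K a).

Let zopen_over a : zopen (over a).
Proof. exact/zopen_rho/zopen_coord_chart. Qed.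

Let regular_pw : regular_on (over 0) pw.
Proof. by apply: regular_on_div => //; [exact: regular_pl|exact: regular_base]. Qed.

Let regular_V : regular_on setT V.
Proof.
have [[_ r0 _ _] [_ r1 _ _]] := (ch0, ch1).
apply: regular_on_local => [|q _]; first exact: zopenT.
have [x0|x0] := eqVneq (px q) 0.
  exists (over 1), (fun q => pl q ^+ n * t1 q +
    \sum_(i < N) Q`_i * px q ^+ (N - i.+1) * py q ^- (N - i)).
  split; [by []|exact: px_py|have oO := zopen_over 1|by move=> y _ /V1].
  apply: regularD => //.
    by apply: regularM => //; apply: regular_onX => //; exact: regular_pl.
  apply: regular_on_sum => // i; apply: regularM => //.
    apply: regularM => //; first exact: regular_cst.
    by apply: regular_onX => //; exact: regular_base.
  apply: regular_onV => //; last by move=> y y0; rewrite expf_neq0.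
  by apply: regular_onX => //; exact: regular_base.
exists (over 0), (fun q => pl q ^+ n * t0 q - (px q)^-1 * A.[pw q]).
split; [by []|by []|have oO := zopen_over 0|by move=> y _ /V0].
apply: regular_onB => //.
  by apply: regularM => //; apply: regular_onX => //; exact: regular_pl.
apply: regularM => //; last exact: regular_on_horner.
by apply: regular_onV => //; exact: regular_base.
Qed.

Let regularT (f : P -> K) (W : set P) : regular_on setT f -> zopen W -> regular_on W f.
Proof. by move=> rf oW; apply: regular_sub rf => //; exact: zopenT. Qed.

Let regular_U : regular_on setT U.
Proof.
have [_ r0 _ _] := ch0; have oT := zopenT P.
apply: regular_on_local => // q _; have [l0|l0] := eqVneq (pl q) 0; last first.
  have oO := zopen_neq0 lP oT (regular_pl oT).
  exists (setT `&` [set q | pl q != 0]),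
    (fun q => (px q * V q - E.[pl q * V q]) / (E0 * pl q ^+ n)).
  split=> //; last by move=> y _ [_ ly]; rewrite /U; case: ifP => //; rewrite ly.
  have rV := regularT regular_V oO; have rl := regular_pl oO.
  apply: regular_on_div => //.
  - apply: regular_onB => //; first by apply: regularM => //; exact: regular_base.
    by apply: regular_on_horner => //; exact: regularM.
  - by apply: regularM => //; [exact: regular_cst|exact: regular_onX].
  - by move=> y [_ ly]; rewrite mulf_neq0 ?expf_neq0.
have oO := zopen_over 0; have rx := regular_base 0 oO; have rw := regular_pw.
have rT : regular_on (over 0) pT by apply: regularM => //; exact: regular_onX.
exists (over 0), (fun q => px q ^- n * (pT q + R.[pw q] -
  pw q * pT q * taylor_quotient E (Phi (pw q)) (pw q ^+ n.+1 * pT q)) / E0).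
split; [by []|exact: pl_px| |by move=> y _ /U0].
apply: regularM => //; last exact: regular_cst.
apply: regularM => //.
  by apply: regular_onV => //; [exact: regular_onX|move=> y y0; rewrite expf_neq0].
apply: regular_onB => //; first by apply: regularD => //; exact: regular_on_horner.
apply: regularM => //; first exact: regularM.
apply: regular_on_taylor_quotient => //.
  by apply: regularM => //; exact: regular_on_horner.
by apply: regularM => //; exact: regular_onX.
Qed.

Let regular_F : regular_map F.
Proof.
have oT := zopenT P; have rl := regular_pl oT; have rV := regular_V.
apply/regular_map_induced/regular_map_affine => // -[[|[|[|[|//]]]] i4].
- apply: (regular_ext oT (f := px')) => [q _|]; first by rewrite mxE.
  apply: regular_onB => //; first exact: regular_base.
  by apply: regularM => //; apply: regular_on_horner => //; exact: regularM.
- by apply: regular_ext rl => // q _; rewrite mxE.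
- apply: regular_ext (regularM oT rV (regular_cst E0^-1 oT)) => // q _.
  by rewrite mxE.
- by apply: regular_ext regular_U => // q _; rewrite mxE.
Qed.

Let F_coords q : [/\ base_x (F q) = px q, sval (F q) 0 iy = pl q,
  E0 * sval (F q) 0 iv = V q & sval (F q) 0 iu = U q].
Proof.
have El : sval (F q) 0 iy = pl q by rewrite mxE.
have Ev : E0 * sval (F q) 0 iv = V q by rewrite mxE /= mulrC divfK.
by split=> //; [rewrite /base_x El Ev mxE /= subrK|rewrite mxE].
Qed.

Let F_iso : is_iso F.
Proof.
split; first exact: regular_F.
have /choice[G FG] := F_surj; exists G.
have GF : cancel F G by move=> q; apply: F_inj; rewrite FG.
split=> //; have lZ := @locally_ringed_hypersurface K n.
have Gx z : px (G z) = base_x z by have [<- _ _ _] := F_coords (G z); rewrite FG.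
have Gl z : pl (G z) = sval z 0 iy by have [_ <- _ _] := F_coords (G z); rewrite FG.
have GV z : V (G z) = E0 * sval z 0 iv by have [_ _ <- _] := F_coords (G z); rewrite FG.
have GU z : U (G z) = sval z 0 iu by have [_ _ _ <-] := F_coords (G z); rewrite FG.
have Gy z : py (G z) = base_y z by rewrite pyE Gx Gl.
have rc (W : set (hypersurface K n)) i : zopen W ->
    regular_on W (fun z : hypersurface K n => sval z 0 i).
  exact: regular_hypersurface_coord.
have rv (W : set (hypersurface K n)) : zopen W ->
    regular_on W (fun z : hypersurface K n => E0 * sval z 0 iv).
  by move=> oW; apply: regularM => //; [exact: regular_cst|exact: rc].
have rx W : zopen W -> regular_on W base_x.
  move=> oW; apply: regularD => //; first exact: rc.
  apply: regularM => //; first exact: rc.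
  by apply: regular_on_horner => //; apply: regularM => //; [exact: rc|exact: rv].
have ry W : zopen W -> regular_on W base_y.
  move=> oW; apply: regularD => //; first exact: rc.
  by apply: regularM => //; [exact: regular_cst|exact: rx].
have oT := zopenT (hypersurface K n).
apply: regular_map_bundle => // [|z].
  apply/regular_map_induced/regular_map_affine => // i.
  have [->|i0] := eqVneq i 0; first by apply: regular_ext (rx _ oT) => // z _; rewrite -Gx.
  apply: regular_ext (ry _ oT) => // z _.
  by rewrite (ord2_eq (a := 0) (b := 1) _ i0)// -Gy.
have oD f : regular_on setT f -> zopen [set z : hypersurface K n | f z != 0].
  by move=> rf; rewrite -[X in zopen X]setTI; exact: zopen_neq0.
have rdiv (W : set (hypersurface K n)) f k g : zopen W -> regular_on W f ->
    regular_on W g -> (forall z, W z -> g z != 0) ->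
    regular_on W (fun z => f z / g z ^+ k).
  move=> oW rf rg g0; apply: regular_on_div => //; first exact: regular_onX.
  by move=> y /g0 gy; rewrite expf_neq0.
have rw W : zopen W -> (forall z, W z -> base_x z != 0) ->
    regular_on W (fun z => sval z 0 iy / base_x z).
  by move=> oW x0; apply: regular_on_div => //; [exact: rc|exact: rx].
have [l0|l0] := eqVneq (sval z 0 iy) 0.
(* near [l = 0] the coordinate [t0] enters [U] with the coefficient [1 - w D],
   which is invertible there because [w] vanishes with [l] *)
- pose w (z : hypersurface K n) := sval z 0 iy / base_x z.
  pose D (z : hypersurface K n) :=
    taylor_quotient E (Phi (w z)) (sval z 0 iy * (E0 * sval z 0 iv) - Phi (w z)).
  have oX := oD _ (rx _ oT); set X := [set z | base_x z != 0] in oX.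
  have rwX : regular_on X w by apply: rw.
  have rPX : regular_on X (fun z => Phi (w z)).
    by apply: regularM => //; exact: regular_on_horner.
  have rDX : regular_on X (fun z => 1 - w z * D z).
    apply: regular_onB => //; first exact: regular_cst.
    apply: regularM => //; apply: regular_on_taylor_quotient => //.
    by apply: regular_onB => //; apply: regularM => //; [exact: rc|exact: rv].
  have oO := zopen_neq0 lZ oX rDX; set O := X `&` _ in oO.
  exists O, (@coord_chart K 0), t0; split=> //.
  + split; first by rewrite /X /= -Gx; apply: pl_px; rewrite Gl.
    by rewrite /= /w l0 !mul0r subr0 oner_neq0.
  + by move=> y [yX _]; rewrite /coord_chart /= -/(px _) Gx.
  + apply: (regular_ext oO (f := fun z : hypersurface K n =>
      ((base_x z ^+ n * (E0 * sval z 0 iu) - R.[w z]) / (1 - w z * D z)) / base_x z ^+ m.+2)).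
      move=> y [yX yD]; have x0 : px (G y) != 0 by rewrite Gx.
      have wE : w y = pw (G y) by rewrite /w /pw Gx Gl.
      have := U0 x0; have := lV x0; rewrite GU Gl GV Gx -wE => lE.
      have -> : taylor_quotient E (Phi (w y)) (w y ^+ n.+1 * pT (G y)) = D y.
        by rewrite /D lE addrC addKr.
      move=> ->; rewrite /= /pT Gx; set T := _ * t0 _.
      rewrite (_ : _ - R.[_] = T * (1 - w y * D y)).
        by rewrite mulfK// /T mulrC mulKf// expf_neq0.
      by field; rewrite E0n expf_neq0.
    have XO f : regular_on X f -> regular_on O f.
      by apply: regular_sub => // y [].
    apply: (rdiv O _ m.+2) => //; [|exact: rx|by move=> y []].
    apply: regular_on_div => //; [|exact: XO|by move=> y []].
    apply: regular_onB => //; last by apply: regular_on_horner => //; exact: XO.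
    apply: regularM => //; first by apply: regular_onX => //; exact: rx.
    by apply: regularM => //; [exact: regular_cst|exact: rc].
- have [x0|x0] := eqVneq (base_x z) 0.
    set O := [set z | base_y z != 0] `&` [set z : hypersurface K n | sval z 0 iy != 0].
    have oO : zopen O by apply: zopenI; apply: oD; [exact: ry|exact: rc].
    exists O, (@coord_chart K 1), t1; split=> //.
    + by split=> //=; rewrite -Gy; apply: px_py; rewrite Gx.
    + by move=> y [y0 _]; rewrite /coord_chart /= -/(py _) Gy.
    + apply: (regular_ext oO (f := fun z : hypersurface K n => (E0 * sval z 0 iv - \sum_(i < N)
        Q`_i * base_x z ^+ (N - i.+1) * base_y z ^- (N - i)) / sval z 0 iy ^+ n)).
        move=> y [y0 ly]; have y0' : py (G y) != 0 by rewrite Gy.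
        have := V1 y0'; rewrite GV Gl => ->; rewrite Gx Gy addrK mulrC mulKf//.
        by rewrite expf_neq0.
      apply: (rdiv) => //; [|exact: rc|by move=> y []].
      apply: regular_onB => //; first exact: rv.
      apply: regular_on_sum => // i; apply: (rdiv O _ (N - i)%N) => //; [|exact: ry|by move=> y []].
      apply: regularM => //; first exact: regular_cst.
      by apply: regular_onX => //; exact: rx.
  set O := [set z | base_x z != 0] `&` [set z : hypersurface K n | sval z 0 iy != 0].
  have oO : zopen O by apply: zopenI; apply: oD; [exact: rx|exact: rc].
  exists O, (@coord_chart K 0), t0; split=> //.
  + by move=> y [y0 _]; rewrite /coord_chart /= -/(px _) Gx.
  + apply: (regular_ext oO (f := fun z : hypersurface K n => (E0 * sval z 0 iv +
      A.[sval z 0 iy / base_x z] / base_x z ^+ 1) / sval z 0 iy ^+ n)).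
      move=> y [y0 ly]; have x0' : px (G y) != 0 by rewrite Gx.
      have := V0 x0'; rewrite GV Gl => ->; rewrite /pw Gx Gl expr1.
      by rewrite [_^-1 * _]mulrC subrK mulrC mulKf// expf_neq0.
    apply: (rdiv) => //; [|exact: rc|by move=> y []].
    apply: regularD => //; first exact: rv.
    apply: (rdiv) => //; [|exact: rx|by move=> y []].
    by apply: regular_on_horner => //; apply: rw => // y [].
Qed.

(** The coordinates [x'], [l], [V / E0] and [U] give the isomorphism.  Its inverse
    is regular because each fibre coordinate of the bundle can be solved for
    locally: from [V] where [l != 0], from [U] near [l = 0]. *)
Lemma glued_isomorphic_hypersurface : exists F : P -> hypersurface K n, is_iso F /\
  forall act : K -> P -> P,
    (forall l x, l != 0 -> sval (rho (act l x)) = l *: sval (rho x)) ->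
    homogeneous_coord m.+2 act 0 t0 -> homogeneous_coord m.+2 act 1 t1 ->
    forall l x, l != 0 -> sval (F (act l x)) = sval (F x) *m diag_mx (weights n l).
Proof.
exists F; split=> [|act actP act0 act1 l q l0]; first exact: F_iso.
have Ex : px (act l q) = l * px q by rewrite /px actP// mxE.
have Ey : py (act l q) = l * py q by rewrite /py actP// mxE.
have El : pl (act l q) = l * pl q by rewrite /pl Ex Ey; ring.
have Ew : pw (act l q) = pw q by rewrite /pw Ex El -mulf_div divff// mul1r.
have EV : V (act l q) = l^-1 * V q.
  rewrite /V Ex mulf_eq0 (negPf l0) /= El Ew Ey exprMn invfM.
  case: ifP => [x0|/negbFE/eqP x0].
    by rewrite act0// [l ^+ m.+2]exprS -/n; field; rewrite l0 x0 expf_neq0.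
  rewrite act1 ?px_py// mulrDr; congr (_ + _).
    by rewrite [l ^+ m.+2]exprS -/n; field; rewrite l0 expf_neq0.
  rewrite mulr_sumr; apply: eq_bigr => -[i /= iN] _.
  rewrite (_ : N - i = (N - i.+1).+1)%N; last by lia.
  rewrite !exprMn [l ^+ _.+1]exprS; field.
  by rewrite l0 !expf_neq0 ?px_py.
have ElV : pl (act l q) * V (act l q) = pl q * V q by rewrite El EV; field.
have ExV : px (act l q) * V (act l q) = px q * V q by rewrite Ex EV; field.
have EU : U (act l q) = l ^- n * U q.
  rewrite /U ElV ExV El mulf_eq0 (negPf l0) /=; case: ifP => [ll|/negbFE/eqP ll].
    by rewrite exprMn; field; rewrite E0n !expf_neq0.
  have x0 := pl_px ll; rewrite /pT Ex act0// !exprMn.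
  by field; rewrite E0n !expf_neq0.
by apply: row4_ext; rewrite mul_mx_diag !mxE /= ?EV ?EU ?El /px' ?ElV ?Ex ?El; ring.
Qed.

End Model.

(** * Point derivations *)
Section Derivations.
Variable K : closedFieldType.
Implicit Types (X Y : space K).

(** Tangent vectors at [x], as derivations on germs of functions.  A regular map
    acts on them by composition, which makes the chain rule automatic. *)
Definition point_derivation X (x : X) (D : (X -> K) -> K) : Prop :=
  [/\ forall c, D (fun=> c) = 0,
      forall U f g, zopen U -> U x -> regular_on U f -> regular_on U g ->
        D (fun y => f y + g y) = D f + D g,
      forall U f g, zopen U -> U x -> regular_on U f -> regular_on U g ->
        D (fun y => f y * g y) = D f * g x + f x * D g &
      forall U f g, zopen U -> U x -> (forall y, U y -> f y = g y) -> D f = D g].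

Lemma point_derivation_map X Y (F : X -> Y) x D : regular_map F ->
  point_derivation x D -> point_derivation (F x) (fun h => D (h \o F)).
Proof.
move=> rF [Dc DD DM Dl]; split=> [c|U f g oU Ux rf rg|U f g oU Ux rf rg|U f g oU Ux fg].
- exact: Dc.
- by have [oV rV] := rF U oU; apply: (DD _ (f \o F) (g \o F) oV) => //; exact: rV.
- by have [oV rV] := rF U oU; apply: (DM _ (f \o F) (g \o F) oV) => //; exact: rV.
- by have [oV _] := rF U oU; apply: (Dl _ _ _ oV) => // y; exact: fg.
Qed.

Lemma mpoly_ring_ind k (C : {mpoly K[k]} -> Prop) :
  (forall c, C c%:MP) -> (forall i, C 'X_i) ->
  (forall p q, C p -> C q -> C (p + q)) -> (forall p q, C p -> C q -> C (p * q)) ->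
  forall p, C p.
Proof.
move=> CC CX CD CM; elim/mpolyind => [|c m p _ _ Cp].
  by rewrite -[0](mpolyC0 k K); exact: CC.
apply: (CD) => //; rewrite -mul_mpolyC; apply: (CM); first exact: CC.
rewrite mpolyXE_id; apply: big_ind => [||i _].
- exact: CC.
- exact: CM.
- by elim: (m i) => [|e IH]; [exact: CC|rewrite exprS; exact: (CM)].
Qed.

Definition differential k (p : {mpoly K[k]}) (z w : 'rV[K]_k) : K :=
  \sum_i peval p^`M(i) z * w 0 i.

Lemma point_derivation_peval X x D k (f : X -> 'rV[K]_k) (p : {mpoly K[k]}) U :
  point_derivation x D -> zopen U -> U x ->
  (forall i, regular_on U (fun y => f y 0 i)) ->
  D (fun y => peval p (f y)) = differential p (f x) (\row_i D (fun y => f y 0 i)).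
Proof.
move=> [Dc DD DM Dl] oU Ux rf.
have rp q : regular_on U (fun y => peval q (f y)) by exact: regular_on_meval.
elim/mpoly_ring_ind: p => [c|i|p q Dp Dq|p q Dp Dq].
- rewrite (Dl _ _ (fun=> c) oU Ux); last by move=> y _; exact: mevalC.
  by rewrite Dc /differential big1 // => i _; rewrite mderivC /peval meval0 mul0r.
- rewrite (Dl _ _ (fun y => f y 0 i) oU Ux); last by move=> y _; exact: mevalXU.
  rewrite /differential (bigD1 i)//= big1 => [|j ji].
    rewrite mderivX mnm1E eqxx scale1r (_ : (U_(i) - U_(i))%MM = 0%MM); last first.
      by apply/mnmP => j; rewrite mnmBE subnn mnm0E.
    rewrite mpolyX0 /peval meval1 mul1r addr0.
    by rewrite mxE.
  by rewrite mderivX mnm1E eq_sym (negPf ji) scale0r /peval meval0 mul0r.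
- rewrite (Dl _ _ (fun y => peval p (f y) + peval q (f y)) oU Ux); last first.
    by move=> y _; exact: mevalD.
  rewrite (DD U)// Dp Dq /differential -big_split /=; apply: eq_bigr => i _.
  by rewrite mderivD [peval (_ + _) _]mevalD mulrDl.
- rewrite (Dl _ _ (fun y => peval p (f y) * peval q (f y)) oU Ux); last first.
    by move=> y _; exact: mevalM.
  rewrite (DM U)// Dp Dq /differential mulr_suml mulr_sumr -big_split /=.
  apply: eq_bigr => i _; rewrite mderivM /peval mevalD !mevalM.
  ring.
Qed.

(** ** Derivations along a curve *)

Definition derivative_at0 (f : affine_space K 1 -> K) (c : K) : Prop :=
  exists p q : {poly K}, [/\ q.[0] != 0,
    forall t, q.[t] != 0 -> f (const_mx t) = p.[t] / q.[t] &
    c = (p^`().[0] * q.[0] - p.[0] * q^`().[0]) / q.[0] ^+ 2].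

Definition derive0 (f : affine_space K 1 -> K) : K := xget 0 [set c | derivative_at0 f c].

Lemma derive0P f c : derivative_at0 f c -> derive0 f = c.
Proof.
move=> fc; apply: (xget_unique 0 (P := [set c | derivative_at0 f c])) => // c'.
move: fc => [p [q [q0 fE ->]]] [r [s [s0 fE' ->]]].
have E : p * s = r * q.
  apply/eqP; rewrite -subr_eq0; apply/eqP.
  apply: (poly_eq0_on_open (q := q * s)).
    by rewrite mulf_neq0 ?(poly_neq0_horner q0) ?(poly_neq0_horner s0).
  move=> t; rewrite hornerM mulf_eq0 negb_or => /andP[qt st].
  have := fE t qt; rewrite fE'// => /eqP; rewrite eqr_div// => /eqP e.
  by rewrite hornerD hornerN !hornerM e mulrC subrr.
have e0 := congr1 (fun u : {poly K} => u.[0]) E.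
have e1 := congr1 (fun u : {poly K} => u^`().[0]) E.
move: e0 e1; rewrite !derivM !hornerD !hornerM.
set P := p.[0]; set Q := q.[0] in q0 *; set R := r.[0]; set S := s.[0] in s0 *.
move=> e0 e1; apply/eqP; rewrite eqr_div ?expf_neq0//; apply/eqP.
have eP : P = R * Q / S by rewrite -e0 mulfK.
have -> : p^`().[0] = (r^`().[0] * Q + R * q^`().[0] - P * s^`().[0]) / S.
  by rewrite -e1 addrK mulfK.
by rewrite eP; field.
Qed.

Lemma derive0_horner (p : {poly K}) :
  derive0 (fun t : affine_space K 1 => p.[t 0 0]) = p^`().[0].
Proof.
apply: derive0P; exists p, 1; rewrite hornerC oner_neq0; split=> // [t _|].
  by rewrite mxE hornerC divr1.
by rewrite derivC horner0 expr1n mulr0 subr0 divr1 mulr1.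
Qed.

Lemma regular_curve_row : regular_curve (fun t => const_mx t : affine_space K 1).
Proof.
apply: regular_map_affine => [|i]; first exact: locally_ringed_affine.
apply: regular_ext (regular_on_coord 0 (zopenT (affine_space K 1))) => [|t _].
  exact: zopenT.
by rewrite mxE.
Qed.

Lemma derive0_point_derivation :
  point_derivation (const_mx 0 : affine_space K 1) derive0.
Proof.
have loc (U : set (affine_space K 1)) f g c : zopen U -> U (const_mx 0) ->
    (forall y, U y -> f y = g y) -> derivative_at0 f c -> derivative_at0 g c.
  move=> oU U0 fg [p [q [q0 fE ->]]].
  have [r [r0 rU]] := regular_curve_open regular_curve_row oU U0.
  exists (p * r), (q * r); split.
  - by rewrite hornerM mulf_neq0.
  - move=> t; rewrite !hornerM mulf_eq0 negb_or => /andP[qt rt].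
    by rewrite -fg ?fE// -?mulf_div ?divff ?mulr1//; exact: rU.
  - by rewrite !derivM !hornerD !hornerM; field; rewrite q0 r0.
have rat (U : set (affine_space K 1)) f : zopen U -> U (const_mx 0) -> regular_on U f ->
    exists p q : {poly K}, q.[0] != 0 /\
      forall t, q.[t] != 0 -> f (const_mx t) = p.[t] / q.[t].
  move=> oU U0 rf; exact: (regular_at_curve regular_curve_row oU rf U0).
split=> [c|U f g oU U0 rf rg|U f g oU U0 rf rg|U f g oU U0 fg].
- have := derive0_horner c%:P; rewrite derivC horner0 => <-; congr derive0.
  by apply/funext => t; rewrite hornerC.
- have [p [q [q0 fE]]] := rat U f oU U0 rf; have [r [s [s0 gE]]] := rat U g oU U0 rg.
  rewrite (derive0P (f := f) (ex_intro _ p (ex_intro _ q (And3 q0 fE erefl)))).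
  rewrite (derive0P (f := g) (ex_intro _ r (ex_intro _ s (And3 s0 gE erefl)))).
  apply: derive0P; exists (p * s + r * q), (q * s); split.
  + by rewrite hornerM mulf_neq0.
  + move=> t; rewrite hornerM mulf_eq0 negb_or => /andP[qt st].
    by rewrite fE// gE// addf_div// hornerD !hornerM.
  + by rewrite derivD !derivM !hornerD !hornerM; field; rewrite q0 s0.
- have [p [q [q0 fE]]] := rat U f oU U0 rf; have [r [s [s0 gE]]] := rat U g oU U0 rg.
  rewrite (derive0P (f := f) (ex_intro _ p (ex_intro _ q (And3 q0 fE erefl)))).
  rewrite (derive0P (f := g) (ex_intro _ r (ex_intro _ s (And3 s0 gE erefl)))).
  rewrite fE// gE//.
  apply: derive0P; exists (p * r), (q * s); split.
  + by rewrite hornerM mulf_neq0.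
  + move=> t; rewrite hornerM mulf_eq0 negb_or => /andP[qt st].
    by rewrite fE// gE// mulf_div !hornerM.
  + by rewrite !derivM !hornerD !hornerM; field; rewrite q0 s0.
- congr (xget 0 _); apply/seteqP; split=> c /=; first exact: loc fg.
  by apply: (loc U) => // y Uy; rewrite fg.
Qed.

(** The derivative of [h \o c] at [0].  Off [O], where [c] is not defined, this
    function is extended by zero, which does not affect its germ at [0]. *)
Lemma curve_derivation X (O : set (affine_space K 1)) (c : induced_space O -> X)
  (O0 : O (const_mx 0)) : zopen O -> regular_map c ->
  exists D, point_derivation (c (exist O _ O0)) D /\
    forall (h : X -> K) (p : {poly K}),
      (forall t : induced_space O, h (c t) = p.[sval t 0 0]) -> D h = p^`().[0].
Proof.
move=> oO rc.
pose ext (f : induced_space O -> K) (t : affine_space K 1) : K :=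
  if pselect (O t) is left Ot then f (exist _ t Ot) else 0.
have extE f t (Ot : O t) : ext f t = f (exist _ t Ot).
  by rewrite /ext; case: pselect => // Ot'; congr f; exact: eq_exist.
have nbhd U : zopen U -> U (c (exist O _ O0)) -> 
    exists V : set (affine_space K 1), [/\ zopen V, V (const_mx 0),
    forall t, V t -> exists Ot : O t, U (c (exist _ t Ot)) &
    forall h, regular_on U h -> regular_on V (ext (h \o c))].
  move=> oU U0; have [[W oW WE] rU] := rc U oU.
  have WP t (Ot : O t) : W t = U (c (exist _ t Ot)).
    by have := congr1 (fun S : set _ => S (exist _ t Ot)) WE.
  exists (O `&` W); split; [exact: zopenI|by rewrite /setI /= WP| |].
    by move=> t [Ot]; rewrite (WP t Ot) => Ut; exists Ot.
  move=> h rh; have oOW := zopenI oO oW.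
  apply: (regular_on_of_induced oO oOW) => [t []//|].
  have -> : @sval _ O @^-1` (O `&` W) = c @^-1` U.
    by rewrite WE; apply/seteqP; split=> -[t Ot] //= [].
  apply: regular_ext (rU h rh) => [|[t Ot] _ /=]; last by rewrite extE.
  by rewrite WE; exists W.
have [Dc DD DM Dl] := derive0_point_derivation.
exists (fun h => derive0 (ext (h \o c))); split; first split.
- move=> a; rewrite (Dl O _ (fun=> a)) ?Dc// => t Ot; exact: extE.
- move=> U f g oU U0 rf rg; have [V [oV V0 VU rV]] := nbhd U oU U0.
  rewrite -(DD V)//; [|exact: rV|exact: rV].
  by apply: (Dl V) => // t /VU[Ot _]; rewrite !extE.
- move=> U f g oU U0 rf rg; have [V [oV V0 VU rV]] := nbhd U oU U0.
  rewrite -[f _](extE (f \o c)) -[g _](extE (g \o c)) -(DM V)//; [|exact: rV|exact: rV].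
  by apply: (Dl V) => // t /VU[Ot _]; rewrite !extE.
- move=> U f g oU U0 fg; have [V [oV V0 VU rV]] := nbhd U oU U0.
  by apply: (Dl V) => // t /VU[Ot Ut]; rewrite !extE /= fg.
- move=> h p hp; rewrite -derive0_horner; apply: (Dl O) => // t Ot.
  by rewrite extE /= hp.
Qed.

End Derivations.

(** * The Jacobian of an isomorphism of model hypersurfaces *)
Section Tangent.
Variables (K : closedFieldType) (n : nat).
Notation Z := (hypersurface K n).
Implicit Types z : Z.

Definition gradient z : 'rV[K]_4 :=
  row4 (sval z 0 iv) (- (n%:R * sval z 0 iy ^+ n.-1 * sval z 0 iu))
       (sval z 0 ix) (- sval z 0 iy ^+ n).

Definition tangent_of (D : (Z -> K) -> K) : 'rV[K]_4 := \row_i D (fun z => sval z 0 i).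

(** A vector field transverse to the hypersurface.  As it is equivariant, it
    serves to extend maps between tangent spaces to the ambient space, where they
    have a determinant, without disturbing the weights. *)
Definition transversal z : 'rV[K]_4 := row4 (sval z 0 ix) 0 0 (sval z 0 iu).

Definition tangent_proj z : 'M[K]_4 := 1%:M - (gradient z)^T *m transversal z.

Lemma mul_row4 (a b : 'rV[K]_4) : (a *m b^T) 0 0 =
  a 0 ix * b 0 ix + a 0 iy * b 0 iy + a 0 iv * b 0 iv + a 0 iu * b 0 iu.
Proof.
rewrite mxE !big_ord_recr big_ord0 /= add0r !mxE.
by congr (_ * _ + _ * _ + _ * _ + _ * _); congr (_ _ _); apply: val_inj.
Qed.

Lemma hypersurfaceP z : sval z 0 ix * sval z 0 iv - sval z 0 iy ^+ n * sval z 0 iu = 1.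
Proof. exact: (svalP z). Qed.

Lemma transversal_gradient z : transversal z *m (gradient z)^T = 1%:M.
Proof.
apply/matrixP => i j; rewrite !ord1 mul_row4 !mxE /= -(hypersurfaceP z); ring.
Qed.

Lemma tangent_proj_gradient z : tangent_proj z *m (gradient z)^T = 0.
Proof. by rewrite mulmxBl mul1mx -mulmxA transversal_gradient mulmx1 subrr. Qed.

Lemma transversal_proj z : transversal z *m tangent_proj z = 0.
Proof. by rewrite mulmxBr mulmx1 mulmxA transversal_gradient mul1mx subrr. Qed.

Lemma point_derivation_expr z D (f : Z -> K) U k : point_derivation z D -> zopen U ->
  U z -> regular_on U f -> D (fun y => f y ^+ k) = k%:R * f z ^+ k.-1 * D f.
Proof.
move=> [Dc DD DM Dl] oU Uz rf; elim: k => [|k IH].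
  by rewrite !mul0r -(Dc 1).
rewrite (Dl U _ (fun y => f y * f y ^+ k)) //; last by move=> y _; rewrite exprS.
rewrite (DM U)//; last exact: regular_onX.
rewrite IH; case: k {IH} => [|k] /=; first by rewrite !mul0r; ring.
by rewrite -[k.+2]addn1 natrD exprS; ring.
Qed.

Lemma tangent_of_gradient z D : point_derivation z D ->
  tangent_of D *m (gradient z)^T = 0.
Proof.
move=> pD; have [Dc DD DM Dl] := pD; have oT := zopenT Z.
have rc i : regular_on setT (fun z => sval z 0 i) by exact: regular_hypersurface_coord.
apply/matrixP => i j; rewrite !ord1 mul_row4 !mxE /=.
have := Dc 1; rewrite (Dl setT _ (fun y => sval y 0 ix * sval y 0 iv +
  (-1) * (sval y 0 iy ^+ n * sval y 0 iu))) //; last first.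
  by move=> y _; rewrite mulN1r hypersurfaceP.
have ry := regular_onX n oT (rc iy).
have rm := regularM oT ry (rc iu).
rewrite (DD setT)//; last 2 first.
- exact: regularM.
- by apply: regularM => //; exact: regular_cst.
rewrite (DM setT) // [D (fun y => -1 * _)](DM setT)//; last exact: regular_cst.
rewrite (DM setT _ _ oT I ry (rc iu)) Dc (point_derivation_expr n pD oT I (rc iy)).
by move=> <-; ring.
Qed.

Lemma point_derivation_fraction z0 (f : Z -> K) : regular_on setT f ->
  exists V (P Q : {mpoly K[4]}), [/\ zopen V, V z0,
    forall z, V z -> peval Q (sval z) != 0 &
    forall z D, V z -> point_derivation z D ->
      D f = (differential P (sval z) (tangent_of D) -
             f z * differential Q (sval z) (tangent_of D)) / peval Q (sval z)].
Proof.
move=> rf; have [//|W [g [oW Wz rg fg]]] := rf z0.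
have [P [Q [Q0 gE]]] := rg _ Wz.
have oT := zopenT Z.
have rc i : regular_on setT (fun z => sval z 0 i) by exact: regular_hypersurface_coord.
have rp p : regular_on setT (fun z : Z => peval p (sval z)) by exact: regular_on_meval.
pose V : set Z := (@sval _ (@on_hypersurface K n) @^-1` W) `&`
  (setT `&` [set z : Z | peval Q (sval z) != 0]).
have oV : zopen V.
  apply: zopenI; first by exists W.
  exact: (zopen_neq0 (@locally_ringed_hypersurface K n)).
exists V, P, Q; split=> //; first by move=> z [_ []].
move=> z D Vz pD; have [Dc DD DM Dl] := pD; have Qz : peval Q (sval z) != 0 by case: Vz => _ [].
have fQ y : V y -> f y * peval Q (sval y) = peval P (sval y).
  by move=> [Wy [_ Qy]]; rewrite fg// gE// divfK.
have dp p : D (fun y => peval p (sval y)) = differential p (sval z) (tangent_of D).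
  exact: (point_derivation_peval (f := fun z : Z => sval z) p pD oT I rc).
have := DM setT f (fun y => peval Q (sval y)) oT I rf (rp Q).
rewrite (Dl V _ (fun y => peval P (sval y)) oV Vz fQ) !dp => ->.
by rewrite addrK mulfK.
Qed.

Lemma differential_row (p : {mpoly K[4]}) (a w : 'rV[K]_4) :
  differential p a w = (w *m \col_i peval p^`M(i) a) 0 0.
Proof. by rewrite mxE; apply: eq_bigr => i _; rewrite mxE mulrC. Qed.

(** A derivation is determined by its values at the coordinates, on which the
    image of a regular function depends linearly. *)
Lemma point_derivation_matrix z (f : 'I_4 -> Z -> K) :
  (forall i, regular_on setT (f i)) ->
  exists C : 'M[K]_4, forall D, point_derivation z D ->
    \row_i D (f i) = tangent_of D *m C.
Proof.
move=> rf; have /choice[c cP] : forall i, exists c : 'cV[K]_4,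
    forall D, point_derivation z D -> D (f i) = (tangent_of D *m c) 0 0.
  move=> i; have [V [P [Q [oV Vz _ E]]]] := point_derivation_fraction z (rf i).
  exists ((peval Q (sval z))^-1 *: ((\col_k peval P^`M(k) (sval z)) -
    f i z *: (\col_k peval Q^`M(k) (sval z)))) => D pD.
  rewrite (E z D Vz pD) !differential_row -scalemxAr mulmxBr -scalemxAr.
  by rewrite [RHS]mxE mulrC !mxE.
exists (\matrix_(k, i) c i k 0) => D pD; apply/rowP => i.
by rewrite mxE (cP i D pD) !mxE; apply: eq_bigr => k _; rewrite !mxE.
Qed.

Lemma hypersurface_xy z : (0 < n)%N -> sval z 0 ix != 0 \/ sval z 0 iy != 0.
Proof.
move=> n0; have [x0|] := eqVneq (sval z 0 ix) 0; last by left.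
have [y0|] := eqVneq (sval z 0 iy) 0; last by right.
by have /eqP := hypersurfaceP z; rewrite x0 y0 expr0n gtn_eqF// !mul0r subr0 eq_sym oner_eq0.
Qed.


(** Where the partial derivative of index [k] does not vanish, the other three
    coordinates can be moved along a straight line at will; the coordinate of
    index [k] follows by solving the equation, and the gradient determines its
    velocity. *)
Lemma tangent_of_curve z (O : set (affine_space K 1)) (c : 'I_4 -> affine_space K 1 -> K)
    (w : 'rV[K]_4) (k : 'I_4) :
  zopen O -> O (const_mx 0) -> gradient z 0 k != 0 -> w *m (gradient z)^T = 0 ->
  (forall t, O t -> on_hypersurface n (\row_i c i t)) ->
  regular_on O (c k) -> c k (const_mx 0) = sval z 0 k ->
  (forall i t, i != k -> c i t = sval z 0 i + t 0 0 * w 0 i) ->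
  exists D, point_derivation z D /\ tangent_of D = w.
Proof.
move=> oO O0 gk wg cZ rk ck0 cE; have oT := zopenT (induced_space O).
pose g (t : induced_space O) : Z := exist (@on_hypersurface K n) _ (cZ (sval t) (svalP t)).
have pE i (t : affine_space K 1) : sval z 0 i + t 0 0 * w 0 i =
    ((sval z 0 i)%:P + w 0 i *: 'X).[t 0 0].
  by rewrite hornerD hornerC hornerZ hornerX mulrC.
have [oS rsv] := @regular_map_sval _ _ O _ oO.
have SE : @sval _ O @^-1` O = setT by apply/seteqP; split=> // -[].
have rg : regular_map g.
  apply/regular_map_induced/regular_map_affine => [|i].
    exact/locally_ringed_induced/locally_ringed_affine.
  apply: (regular_ext oT (f := fun t : induced_space O => c i (sval t))) => [t _|].
    by rewrite mxE.
  rewrite -SE; apply: (rsv (c i)); have [->//|ik] := eqVneq i k.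
  apply: (regular_ext oO (f := fun t : affine_space K 1 =>
      ((sval z 0 i)%:P + w 0 i *: 'X).[t 0 0])).
    by move=> t _; rewrite cE// pE.
  by apply: regular_on_horner => //; exact: regular_on_coord.
have g0 : g (exist _ _ O0) = z.
  apply: eq_sig_hprop => [? ? ?|]; first exact: Prop_irrelevance.
  apply/rowP => i; rewrite mxE /=; have [->//|ik] := eqVneq i k.
  by rewrite cE// mxE mul0r addr0.
have [D []] := curve_derivation O0 oO rg; rewrite g0 => pD DE.
have wE i : i != k -> tangent_of D 0 i = w 0 i.
  move=> ik; rewrite mxE (DE _ ((sval z 0 i)%:P + w 0 i *: 'X)).
    by rewrite derivD derivC add0r derivZ derivX hornerZ hornerC mulr1.
  by move=> t; rewrite mxE cE// pE.
exists D; split=> //; apply/rowP => i; have [->|] := eqVneq i k; last exact: wE.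
have := tangent_of_gradient pD; rewrite -wg => /matrixP/(_ 0 0).
rewrite !mxE !(bigD1 k (P := predT))//= => /eqP.
rewrite (eq_bigr (fun i => w 0 i * (gradient z)^T i 0)) => [|j jk]; last by rewrite wE.
by rewrite (inj_eq (addIr _)) ![(gradient z)^T _ _]mxE => /eqP/(mulIf gk) <-; rewrite mxE.
Qed.

(** On the hypersurface [x] or [y] does not vanish, and these are the partial
    derivatives in the directions of [v] and [u], up to a power and a sign. *)
Lemma tangent_of_surjective z (w : 'rV[K]_4) : (0 < n)%N -> w *m (gradient z)^T = 0 ->
  exists D, point_derivation z D /\ tangent_of D = w.
Proof.
move=> n0 wg; have lA := @locally_ringed_affine K 1; have oT := zopenT (affine_space K 1).
have rl i : regular_on setT (fun t : affine_space K 1 => sval z 0 i + t 0 0 * w 0 i).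
  apply: regularD => //; first exact: regular_cst.
  by apply: regularM => //; [exact: regular_on_coord|exact: regular_cst].
pose c i (t : affine_space K 1) := sval z 0 i + t 0 0 * w 0 i.
have c0 i : c i (const_mx 0) = sval z 0 i by rewrite /c mxE mul0r addr0.
have oO i : zopen (setT `&` [set t | c i t != 0]) by apply: zopen_neq0 => //; exact: rl.
have rc k i : regular_on (setT `&` [set t | c k t != 0]) (c i).
  exact: (regular_sub oT (oO k) _ (rl i)).
have zP := hypersurfaceP z.
have [x0|y0] := hypersurface_xy z n0.
- apply: (@tangent_of_curve z (setT `&` [set t | c ix t != 0]) (fun i t => if i == iv
    then (1 + c iy t ^+ n * c iu t) / c ix t else c i t) w iv) => //.
  + by split=> //=; rewrite c0.
  + by rewrite mxE.
  + by move=> t [_ ct]; rewrite /on_hypersurface !mxE /= mulrC divfK// addrK.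
  + apply: regular_on_div => //; last by move=> t [].
    apply: regularD => //; first exact: regular_cst.
    by apply: regularM => //; apply: regular_onX.
  + by rewrite /= !c0 -zP subrK mulrC mulKf.
  + by move=> i t iv'; rewrite (negPf iv').
- apply: (@tangent_of_curve z (setT `&` [set t | c iy t != 0]) (fun i t => if i == iu
    then (c ix t * c iv t - 1) / c iy t ^+ n else c i t) w iu) => //.
  + by split=> //=; rewrite c0.
  + by rewrite mxE oppr_eq0 expf_neq0.
  + move=> t [_ ct]; rewrite /on_hypersurface !mxE /= [_ ^+ n * _]mulrC divfK ?expf_neq0//.
    by rewrite subKr.
  + apply: regular_on_div => //; last by move=> t [_ ct]; rewrite expf_neq0.
      by apply: regular_onB => //; [exact: regularM|exact: regular_cst].
    exact: regular_onX.
  + by rewrite /= !c0 -zP subKr mulrC mulKf// expf_neq0.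
  + by move=> i t iu'; rewrite (negPf iu').
Qed.

End Tangent.

Section Differential.
Variables (K : closedFieldType) (n m : nat).
Hypothesis n0 : (0 < n)%N.
Variable F : hypersurface K n -> hypersurface K m.
Hypothesis rF : regular_map F.
Notation Z := (hypersurface K n).
Implicit Types z : Z.

Let outer_mx (a b : 'rV[K]_4) i k : (a^T *m b) i k = a 0 i * b 0 k.
Proof. by rewrite mxE big_ord1 mxE. Qed.

Let rFc i : regular_on setT (fun z => sval (F z) 0 i).
Proof.
have oT := zopenT (hypersurface K m).
have [_ H] := rF oT.
exact: (H (fun y => sval y 0 i) (regular_hypersurface_coord i oT)).
Qed.

Lemma tangent_of_map z D : point_derivation z D ->
  tangent_of (fun h => D (h \o F)) = \row_i D (fun z => sval (F z) 0 i).
Proof. by move=> pD; apply/rowP => i; rewrite !mxE. Qed.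

(** A matrix that represents the differential of [F] at [z]; only its effect on
    tangent vectors is determined. *)
Definition differential_mx z : 'M[K]_4 :=
  sval (cid (point_derivation_matrix z rFc)).

(** The linear map that is the differential of [F] on tangent vectors and sends
    the transversal vector at [z] to that at [F z].  The factor [tangent_proj z]
    makes it independent of the choice of [differential_mx z]. *)
Definition jacobian z : 'M[K]_4 :=
  tangent_proj z *m differential_mx z + (gradient z)^T *m transversal (F z).

Lemma differential_mxP z D : point_derivation z D ->
  \row_i D (fun z => sval (F z) 0 i) = tangent_of D *m differential_mx z.
Proof. by rewrite /differential_mx; case: cid => C /= CP pD; exact: CP. Qed.

Lemma tangent_projP z i :
  exists D, point_derivation z D /\ tangent_of D = row i (tangent_proj z).
Proof.
by apply: tangent_of_surjective => //; rewrite -row_mul tangent_proj_gradient row0.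
Qed.

Lemma differential_tangent z :
  tangent_proj z *m differential_mx z *m (gradient (F z))^T = 0.
Proof.
apply/row_matrixP => i; rewrite !row_mul row0.
have [D [pD <-]] := tangent_projP z i; rewrite -(differential_mxP pD) -(tangent_of_map pD).
exact/tangent_of_gradient/point_derivation_map.
Qed.

(** Locally [F] is given by fractions, and their quotient rule computes the
    differential in the tangent directions that are the rows of [tangent_proj]. *)
Lemma regular_jacobian i j : regular_on setT (fun z => jacobian z i j).
Proof.
have oT := zopenT Z; have lZ := @locally_ringed_hypersurface K n.
have rc k : regular_on setT (fun z => sval z 0 k) by exact: regular_hypersurface_coord.
have rg k : regular_on setT (fun z => gradient z 0 k).
  apply: (regular_ext oT (f := fun z : Z => [:: sval z 0 iv;
    - (n%:R * sval z 0 iy ^+ n.-1 * sval z 0 iu); sval z 0 ix; - sval z 0 iy ^+ n]`_k)).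
    by move=> z _; rewrite mxE.
  case: k => -[|[|[|[|//]]]] k4.
  - exact: rc.
  - apply: (@regular_onN _ Z _ (fun z => n%:R * sval z 0 iy ^+ n.-1 * sval z 0 iu)) => //.
    apply: regularM => //; apply: regularM => //.
      exact: regular_cst.
    exact: regular_onX.
  - exact: rc.
  - by apply: (@regular_onN _ Z _ (fun z => sval z 0 iy ^+ n)) => //; exact: regular_onX.
have rt (W : Z -> 'rV[K]_4) k : (forall l, regular_on setT (fun z => W z 0 l)) ->
    regular_on setT (fun z => row4 (W z 0 ix) 0 0 (W z 0 iu) 0 k).
  move=> rW; apply: (regular_ext oT (f := fun z => [:: W z 0 ix; 0; 0; W z 0 iu]`_k)).
    by move=> z _; rewrite mxE.
  by case: k => -[|[|[|[|//]]]] k4; [exact: rW|exact: regular_cst|exact: regular_cst|exact: rW].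
have rp k : regular_on setT (fun z => tangent_proj z i k).
  apply: (regular_ext oT (f := fun z : Z =>
    (1%:M : 'M[K]_4) i k - gradient z 0 i * transversal z 0 k)).
    by move=> z _; rewrite /tangent_proj [RHS]mxE [X in _ = _ + X]mxE outer_mx.
  apply: regular_onB => //; first exact: regular_cst.
  by apply: regularM => //; apply: rt.
apply: (regular_ext oT (f := fun z => (tangent_proj z *m differential_mx z) i j +
  gradient z 0 i * transversal (F z) 0 j)).
  by move=> z _; rewrite /jacobian [RHS]mxE outer_mx.
apply: regularD => //; last by apply: regularM => //; exact: (rt (fun z => sval (F z))).
apply: regular_on_local => // z0 _.
have [V [P [Q [oV Vz Qn E]]]] := point_derivation_fraction z0 (rFc j).
pose dp p z := \sum_k peval p^`M(k) (sval z) * tangent_proj z i k.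
have rd p : regular_on V (dp p).
  apply: (regular_sub oT oV) => //; apply: regular_on_sum => // k.
  by apply: regularM => //; exact: regular_on_meval.
exists V, (fun z => (dp P z - sval (F z) 0 j * dp Q z) / peval Q (sval z)); split=> //.
  apply: regular_on_div => //.
    apply: regular_onB => //; apply: regularM => //.
    exact: (regular_sub oT oV _ (rFc j)).
  by apply: regular_on_meval => // k; exact: (regular_sub oT oV _ (rc k)).
move=> z _ Vz'; have [D [pD DE]] := tangent_projP z i.
have := E z D Vz' pD; rewrite DE /differential /dp.
under eq_bigr => k _ do rewrite [row _ _ _ _]mxE.
under [in X in _ - X]eq_bigr => k _ do rewrite [row _ _ _ _]mxE.
move=> <-; have := differential_mxP pD; rewrite DE -row_mul => /rowP/(_ j).
by rewrite mxE [RHS]mxE => ->.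
Qed.

End Differential.

Section Scaling.
Variables (K : closedFieldType) (n : nat) (l : K).
Hypothesis l0 : l != 0.
Notation Z := (hypersurface K n).

Lemma scale_subproof (z : Z) : on_hypersurface n (sval z *m diag_mx (weights n l)).
Proof.
rewrite /on_hypersurface mul_mx_diag !mxE /= -[RHS](hypersurfaceP z) exprMn.
by field; rewrite l0 expf_neq0.
Qed.

Definition scale (z : Z) : Z := exist (@on_hypersurface K n) _ (scale_subproof z).

Lemma scaleE (z : Z) i : sval (scale z) 0 i = sval z 0 i * weights n l 0 i.
Proof. by rewrite /= mul_mx_diag [LHS]mxE. Qed.

Lemma regular_map_scale : regular_map scale.
Proof.
have oT := zopenT Z; apply/regular_map_induced/regular_map_affine => [|i].
  exact: locally_ringed_hypersurface.
apply: (regular_ext oT (f := fun z : Z => sval z 0 i * weights n l 0 i)).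
  by move=> z _; exact/esym/scaleE.
by apply: regularM => //; [exact: regular_hypersurface_coord|exact: regular_cst].
Qed.

Lemma det_weights : \det (diag_mx (weights n l)) = l * l ^- n.
Proof.
rewrite det_diag !big_ord_recr big_ord0 /= !mxE /=.
by field; rewrite l0 expf_neq0.
Qed.

Lemma transversal_scale (z : Z) : transversal (scale z) = transversal z *m diag_mx (weights n l).
Proof.
have := scaleE z; rewrite /transversal; move: (sval (scale z)) => w wE.
by apply: row4_ext; rewrite mul_mx_diag [RHS]mxE ![row4 _ _ _ _ _ _]mxE /= ?wE ?mul0r// mxE.
Qed.

Lemma gradient_scale (z : Z) : (0 < n)%N ->
  diag_mx (weights n l) *m (gradient (scale z))^T = (gradient z)^T.
Proof.
move=> n0; rewrite -[LHS]trmxK; congr trmx; rewrite trmx_mul trmxK tr_diag_mx.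
have nE : l ^+ n = l * l ^+ n.-1 by rewrite -exprS prednK.
have := scaleE z; rewrite /gradient; move: (sval (scale z)) => w wE.
apply: row4_ext; rewrite mul_mx_diag [LHS]mxE !mxE /= ?wE !mxE /= ?exprMn ?nE;
  by field; rewrite ?l0 ?expf_neq0.
Qed.

End Scaling.

Section Comparison.
Variables (K : closedFieldType) (n m : nat).
Hypothesis n0 : (0 < n)%N.
Variables (F : hypersurface K n -> hypersurface K m) (G : hypersurface K m -> hypersurface K n).
Hypotheses (rF : regular_map F) (rG : regular_map G) (FK : cancel F G).
Hypothesis equi : forall (l : K) z z', l != 0 ->
  sval z' = sval z *m diag_mx (weights n l) -> sval (F z') = sval (F z) *m diag_mx (weights m l).
Implicit Types z : hypersurface K n.

(** The chain rule, since the Jacobian of the identity is the identity. *)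
Lemma jacobian_inverse z : jacobian rF z *m jacobian rG (F z) = 1%:M.
Proof.
rewrite /jacobian FK.
set p := tangent_proj z; set c := differential_mx rF z; set g := (gradient z)^T.
set p' := tangent_proj (F z); set c' := differential_mx rG (F z).
set g' := (gradient (F z))^T; set t := transversal z; set t' := transversal (F z).
have pcg : p *m c *m g' = 0 by exact: differential_tangent.
have pc : p *m c *m c' = p.
  apply/row_matrixP => i; rewrite !row_mul.
  have [D [pD DE]] := tangent_projP n0 z i.
  rewrite -DE -(differential_mxP rF pD) -(tangent_of_map F pD).
  rewrite -(differential_mxP rG (point_derivation_map rF pD)).
  by apply/rowP => k; rewrite !mxE; congr D; apply/funext => y /=; rewrite FK.
have pp' : p *m c *m p' = p *m c.
  by rewrite /p' mulmxBr mulmx1 [in X in _ - X]mulmxA pcg mul0mx subr0.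
rewrite mulmxDl !mulmxDr [p *m c *m (p' *m c')]mulmxA pp' pc.
rewrite [p *m c *m (g' *m t)]mulmxA pcg mul0mx addr0.
rewrite -[g *m t' *m (p' *m c')]mulmxA [t' *m (p' *m c')]mulmxA transversal_proj.
rewrite mul0mx mulmx0 add0r -mulmxA [t' *m (g' *m t)]mulmxA transversal_gradient mul1mx.
by rewrite /p /tangent_proj subrK.
Qed.

(** The differential of [F] intertwines the two linear actions of [l], and so
    does the correspondence of transversal vectors. *)
Lemma jacobian_scale l (l0 : l != 0) z :
  diag_mx (weights n l) *m jacobian rF (scale l0 z) = jacobian rF z *m diag_mx (weights m l).
Proof.
set W := diag_mx _; set W' := diag_mx _; set sz := scale l0 z.
have Fs z1 : sval (F (scale l0 z1)) = sval (F z1) *m W' by exact: equi.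
have gW : W *m (gradient sz)^T = (gradient z)^T by exact: gradient_scale.
have pW : W *m tangent_proj sz = tangent_proj z *m W.
  rewrite /tangent_proj mulmxBr mulmxBl mulmx1 mul1mx mulmxA gW.
  by rewrite transversal_scale mulmxA.
rewrite /jacobian mulmxDr mulmxDl !mulmxA pW gW; congr (_ + _); last first.
  rewrite -[RHS]mulmxA; congr (_ *m _).
  by rewrite -(transversal_scale l0); congr transversal; apply: eq_sig_hprop => [? ? ?|];
    [exact: Prop_irrelevance|rewrite Fs].
apply/row_matrixP => i; rewrite !row_mul.
have [D [pD DE]] := tangent_projP n0 z i; rewrite -DE.
have pD' := point_derivation_map (regular_map_scale l0 (n := n)) pD.
have <- : tangent_of (fun h => D (h \o scale l0 (n:=n))) = tangent_of D *m W.
  have [Dc DD DM Dl] := pD; have oT := zopenT (hypersurface K n).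
  apply/rowP => k; rewrite mul_mx_diag [RHS]mxE ![tangent_of _ 0 k]mxE.
  rewrite (Dl _ _ (fun z => sval z 0 k * weights n l 0 k) oT)//; last first.
    by move=> y _; rewrite /= mul_mx_diag [LHS]mxE.
  rewrite (DM setT _ _ oT)//; last 2 first.
  - exact: regular_hypersurface_coord.
  - exact: regular_cst.
  by rewrite Dc mulr0 addr0.
rewrite /sz -(differential_mxP rF pD') -(differential_mxP rF pD).
have [Dc DD DM Dl] := pD; have oT := zopenT (hypersurface K n).
apply/rowP => k; rewrite mul_mx_diag [LHS]mxE [RHS]mxE [X in _ = X * _]mxE.
rewrite (Dl _ _ (fun z => sval (F z) 0 k * weights m l 0 k) oT)//; last first.
  by move=> y _; rewrite /= Fs mul_mx_diag [LHS]mxE.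
rewrite (DM setT _ _ oT)//; last 2 first.
- have [_ H] := rF (zopenT (hypersurface K m)).
  exact: (H (fun y => sval y 0 k) (regular_hypersurface_coord k (zopenT _))).
- exact: regular_cst.
by rewrite Dc mulr0 addr0.
Qed.

Let J z : K := \det (jacobian rF z).

Let J0 z : J z != 0.
Proof.
apply/eqP => Jz; have /eqP := congr1 determinant (jacobian_inverse z).
by rewrite det_mulmx -/(J z) Jz mul0r det1 eq_sym oner_eq0.
Qed.

Let regular_J : regular_on setT J.
Proof.
have oT := zopenT (hypersurface K n).
apply: regular_on_sum => // s; apply: regularM => //; first exact: regular_cst.
by apply: regular_on_prod => // i; exact: regular_jacobian.
Qed.

(** A nowhere vanishing regular function is constant along any curve that the
    whole affine line parametrizes. *)
Let J_line (a b c d : {poly K}) t t' (z z' : hypersurface K n) :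
  (forall s, on_hypersurface n (row4 a.[s] b.[s] c.[s] d.[s])) ->
  sval z = row4 a.[t] b.[t] c.[t] d.[t] -> sval z' = row4 a.[t'] b.[t'] c.[t'] d.[t'] ->
  J z = J z'.
Proof.
move=> gZ zE zE'; have oT := zopenT (affine_space K 1).
pose g s : hypersurface K n := exist (@on_hypersurface K n) _ (gZ s).
have rg : regular_curve g.
  apply/regular_map_induced/regular_map_affine => [|i]; first exact: locally_ringed_affine.
  apply: (regular_ext oT (f := fun s : affine_space K 1 => ([:: a; b; c; d]`_i).[s 0 0])).
    by case: i => -[|[|[|[|//]]]] i4 s _; rewrite mxE.
  by apply: regular_on_horner => //; exact: regular_on_coord.
have gE s z1 : sval z1 = row4 a.[s] b.[s] c.[s] d.[s] -> z1 = g s.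
  by move=> E; apply: eq_sig_hprop => [? ? ?|//]; exact: Prop_irrelevance.
rewrite (gE _ _ zE) (gE _ _ zE').
have gJ := @regular_unit_const _ (J \o g) _ (fun s => J0 (g s)).
have rJ s : regular_at (J \o g) s.
  exact: (regular_at_curve rg (zopenT (hypersurface K n)) regular_J).
by rewrite [LHS](gJ rJ t) [RHS](gJ rJ t').
Qed.

(** The points with a given [y != 0] form an affine plane with coordinates [x]
    and [v]; the two lines used are parallel to its axes. *)
Let J_y z z' : sval z 0 iy != 0 -> sval z 0 iy = sval z' 0 iy -> J z = J z'.
Proof.
set y := sval z 0 iy => y0 yE; have yn : y ^+ n != 0 by rewrite expf_neq0.
have uE (z1 : hypersurface K n) : sval z1 0 iy = y ->
    sval z1 0 iu = (sval z1 0 ix * sval z1 0 iv - 1) / y ^+ n.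
  move=> yE1; apply: (mulIf yn); rewrite divfK//.
  by rewrite -[X in _ - X](hypersurfaceP z1) subKr yE1 mulrC.
have on x v : on_hypersurface n (row4 x y v ((x * v - 1) / y ^+ n)).
  by rewrite /on_hypersurface !mxE /= mulrC [_ ^+ n * _]mulrC divfK// mulrC subKr.
pose zm : hypersurface K n := exist (@on_hypersurface K n) _ (on (sval z' 0 ix) (sval z 0 iv)).
transitivity (J zm).
  apply: (@J_line 'X y%:P (sval z 0 iv)%:P (('X * (sval z 0 iv)%:P - 1) * (y ^- n)%:P)
    (sval z 0 ix) (sval z' 0 ix)).
  - by move=> s; rewrite !hornerE; exact: on.
  - by apply: row4_ext; rewrite [RHS]mxE /= ?hornerE// uE// !hornerE.
  - by apply: row4_ext; rewrite !mxE /= !hornerE.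
apply: (@J_line (sval z' 0 ix)%:P y%:P 'X (((sval z' 0 ix)%:P * 'X - 1) * (y ^- n)%:P)
  (sval z 0 iv) (sval z' 0 iv)).
- by move=> s; rewrite !hornerE; exact: on.
- by apply: row4_ext; rewrite !mxE /= !hornerE.
- by apply: row4_ext; rewrite [RHS]mxE /= ?hornerE// uE// !hornerE.
Qed.

Let J_x z z' : sval z 0 ix != 0 -> sval z 0 ix = sval z' 0 ix -> J z = J z'.
Proof.
set x := sval z 0 ix => x0 xE.
have vE (z1 : hypersurface K n) : sval z1 0 ix = x ->
    sval z1 0 iv = (1 + sval z1 0 iy ^+ n * sval z1 0 iu) / x.
  move=> xE1; apply: (mulIf x0); rewrite divfK//.
  by rewrite -[X in X + _](hypersurfaceP z1) subrK xE1 mulrC.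
have on y u : on_hypersurface n (row4 x y ((1 + y ^+ n * u) / x) u).
  by rewrite /on_hypersurface !mxE /= mulrC divfK// addrK.
pose zm : hypersurface K n := exist (@on_hypersurface K n) _ (on (sval z' 0 iy) (sval z 0 iu)).
transitivity (J zm).
  apply: (@J_line x%:P 'X ((1 + 'X^n * (sval z 0 iu)%:P) * x^-1%:P) (sval z 0 iu)%:P
    (sval z 0 iy) (sval z' 0 iy)).
  - by move=> s; rewrite !hornerE; exact: on.
  - by apply: row4_ext; rewrite [RHS]mxE /= ?hornerE// vE// !hornerE.
  - by apply: row4_ext; rewrite !mxE /= !hornerE.
apply: (@J_line x%:P (sval z' 0 iy)%:P ((1 + (sval z' 0 iy ^+ n) *: 'X) * x^-1%:P) 'X
    (sval z 0 iu) (sval z' 0 iu)).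
- by move=> s; rewrite !hornerE; exact: on.
- by apply: row4_ext; rewrite !mxE /= !hornerE.
- by apply: row4_ext; rewrite [RHS]mxE /= ?hornerE// vE// !hornerE.
Qed.

(** Since the Jacobian determinant depends on [x] only where [x != 0] and on
    [y] only where [y != 0], it is constant; its weight, the difference of the
    weights of the two volume forms, must then vanish. *)
Lemma hypersurface_weight_eq : n = m.
Proof.
have on (l : K) : on_hypersurface n (row4 1 l 1 0).
  by rewrite /on_hypersurface !mxE /= mulr0 subr0 mulr1.
pose e (l : K) : hypersurface K n := exist (@on_hypersurface K n) _ (on l).
have lE (l : K) : l != 0 -> l ^+ n = l ^+ m.
  move=> l0; have := congr1 determinant (jacobian_scale l0 (e 1)).
  rewrite !det_mulmx !det_weights// -/(J _) -/(J (e 1)).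
  have -> : J (scale l0 (e 1)) = J (e 1).
    transitivity (J (e l)).
      by apply: J_y; rewrite /= mul_mx_diag !mxE /= ?mul1r// mul_mx_diag !mxE /= mul1r.
    by apply: J_x; rewrite !mxE //= oner_neq0.
  rewrite mulrC => /(mulfI (J0 _))/(mulfI l0)/invr_inj; exact.
apply/eqP/negPn/negP => nm.
suff /eqP : 'X^n - 'X^m = 0 :> {poly K}.
  rewrite subr_eq0 => /eqP/(congr1 (fun p : {poly K} => size p)).
  by rewrite !size_polyXn => -[/eqP]; rewrite (negPf nm).
apply: (poly_eq0_on_open (q := 'X)); first by rewrite polyX_eq0.
by move=> l; rewrite hornerX => l0; rewrite hornerD hornerN !hornerXn lE// subrr.
Qed.

End Comparison.

(** * Comparison with the models *)
Section Isomorphisms.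
Variable K : closedFieldType.
Implicit Types X Y W : space K.

Lemma is_iso_comp X Y W (f : X -> Y) (g : Y -> W) :
  is_iso f -> is_iso g -> is_iso (g \o f).
Proof.
move=> [rf [f' [rf' fK f'K]]] [rg [g' [rg' gK g'K]]].
split; first exact: regular_map_comp rf rg.
exists (f' \o g'); split; first exact: regular_map_comp rg' rf'.
- by move=> x; rewrite /= gK fK.
- by move=> x; rewrite /= f'K g'K.
Qed.

Lemma is_iso_inv X Y (f : X -> Y) : is_iso f ->
  exists g, [/\ is_iso g, cancel f g & cancel g f].
Proof. by move=> [rf [g [rg fK gK]]]; exists g; split=> //; split=> //; exists f. Qed.

Lemma is_affine_isomorphic X Y : isomorphic X Y -> is_affine Y -> is_affine X.
Proof.
move=> [f fi] [k [Z [oZ [g gi]]]]; exists k, Z; split=> //.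
by exists (g \o f); exact: is_iso_comp.
Qed.

End Isomorphisms.

Lemma homogeneous_bundle_hypersurface (K : closedFieldType) (P : Ga_bundle K) d (I : Type)
    (U : I -> set (punctured_plane K)) (tau : I -> P -> K)
    (g : I -> I -> punctured_plane K -> K) :
  [pchar K] =i pred0 -> (2 <= d)%N -> ~ trivial_bundle P ->
  (forall i, Gm_stable (U i) /\ chart (U i) (tau i)) -> (forall u, exists i, U i u) ->
  (forall i j, homogeneous_function d (U i `&` U j) (g i j)) ->
  (forall i j x, (U i `&` U j) (rho x) -> tau i x = tau j x + g i j (rho x)) ->
  exists F : P -> hypersurface K d.-1, is_iso F /\
    forall act : K -> P -> P,
      (forall l x, l != 0 -> sval (rho (act l x)) = l *: sval (rho x)) ->
      (forall i l x, l != 0 -> U i (rho x) -> tau i (act l x) = l ^- d * tau i x) ->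
      forall l x, l != 0 -> sval (F (act l x)) = sval (F x) *m diag_mx (weights d.-1 l).
Proof.
case: d => [|[|m]]// char0 _ ntriv charts cover hom cocycle.
have [t0 [t1 [N [p [mN glued actP]]]]] := laurent_cocycle (fun i => (charts i).1)
  cover (fun i => (charts i).2) hom cocycle m.+2.
have [s gen] := generic_direction char0 mN glued ntriv.
have [E [R ER]] := polar_part_inversion mN gen.
have [F [iF Fact]] := glued_isomorphic_hypersurface mN glued gen ER.
exists F; split=> // act act1 act2; have [h0 h1] := actP act act1 act2.
exact: Fact.
Qed.

Lemma homogeneous_lift_hypersurface (K : closedFieldType) (P : Ga_bundle K) d (s : Gm_lift P) :
  [pchar K] =i pred0 -> (2 <= d)%N -> ~ trivial_bundle P -> homogeneous_lift d s ->
  exists F : P -> hypersurface K d.-1, is_iso F /\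
    forall l x, l != 0 -> sval (F (s l x)) = sval (F x) *m diag_mx (weights d.-1 l).
Proof.
move=> char0 d2 ntriv /homogeneous_lift_cover[I [U [tau [g [ch cov hom coc act]]]]].
have [F [iF Fact]] := homogeneous_bundle_hypersurface char0 d2 ntriv ch cov hom coc.
by exists F; split=> //; apply: Fact => //; exact: rho_Gm_act.
Qed.

Lemma class_in_degree_hypersurface (K : closedFieldType) (P : Ga_bundle K) d :
  [pchar K] =i pred0 -> (2 <= d)%N -> homogeneous_bundle d P ->
  isomorphic P (hypersurface K d.-1).
Proof.
move=> char0 d2 [ntriv [I [U [tau [g [oU cov triv hom coc]]]]]].
have ch i : Gm_stable (U i) /\ chart (U i) (tau i).
  by have [oUi sU] := oU i; split=> //; exact: trivialization_chart.
have [F [iF _]] := homogeneous_bundle_hypersurface char0 d2 ntriv ch cov hom coc.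
by exists F.
Qed.

Lemma equivariantly_isomorphic_degree (K : closedFieldType) d d' (P P' : Ga_bundle K)
    (s : Gm_lift P) (s' : Gm_lift P') : [pchar K] =i pred0 ->
  (2 <= d)%N -> (2 <= d')%N -> ~ trivial_bundle P -> ~ trivial_bundle P' ->
  homogeneous_lift d s -> homogeneous_lift d' s' ->
  equivariantly_isomorphic s s' <-> d = d'.
Proof.
move=> char0 d2 d2' ntriv ntriv' hs hs'.
have [F [iF Fs]] := homogeneous_lift_hypersurface char0 d2 ntriv hs.
have [F' [iF' Fs']] := homogeneous_lift_hypersurface char0 d2' ntriv' hs'.
have [G [iG FG GF]] := is_iso_inv iF; have [G' [iG' FG' GF']] := is_iso_inv iF'.
have svalK k (z z' : hypersurface K k) : sval z = sval z' -> z = z'.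
  by move=> E; apply: eq_sig_hprop => [? ? ?|//]; exact: Prop_irrelevance.
split=> [[f [fi fs]]|dd'].
  have [g [gi fg gf]] := is_iso_inv fi.
  have [rH _] := is_iso_comp (is_iso_comp iG fi) iF'.
  have [rH' _] := is_iso_comp (is_iso_comp iG' gi) iF.
  suff : d.-1 = d'.-1 by lia.
  apply: (@hypersurface_weight_eq K _ _ _ _ _ rH rH').
  - by lia.
  - by move=> z; rewrite /= FG' fg GF.
  - move=> l z z' l0 zz'; have <- : F (s l (G z)) = z'.
      by apply: svalK; rewrite Fs// GF zz'.
    by rewrite /= FG fs// Fs'.
subst d'; exists (G' \o F); split; first exact: is_iso_comp.
move=> l x l0 /=; apply: (can_inj FG'); rewrite GF'.
by apply: svalK; rewrite Fs// Fs'// GF'.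
Qed.

Theorem theorem2p3 (R : realType) :
  (forall (d d' : nat) (P P' : Ga_bundle (complex R)) (s : Gm_lift P) (s' : Gm_lift P'),
     (2 <= d)%N -> (2 <= d')%N ->
     homogeneous_bundle d P -> homogeneous_bundle d' P' ->
     homogeneous_lift d s -> homogeneous_lift d' s' ->
     (equivariantly_isomorphic s s' <-> d = d')) /\
  (forall d : nat, (2 <= d)%N ->
     (forall P : Ga_bundle (complex R), homogeneous_bundle d P -> is_affine P) /\
     (forall P P' : Ga_bundle (complex R),
        homogeneous_bundle d P -> homogeneous_bundle d P' -> isomorphic P P')).
Proof.
have char0 : [pchar (complex R : closedFieldType)] =i pred0 by exact: Num.Theory.pchar_num.
split=> [d d' P P' s s' d2 d2' [ntriv _] [ntriv' _] hs hs'|d d2].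
  exact: equivariantly_isomorphic_degree.
have iso (P : Ga_bundle (complex R)) : homogeneous_bundle d P ->
    isomorphic P (hypersurface (complex R) d.-1).
  exact: class_in_degree_hypersurface.
split=> [P /iso|P P' /iso[F iF] /iso[F' iF']].
  by move/is_affine_isomorphic; apply; exact: hypersurface_is_affine.
by have [G' [iG' _ _]] := is_iso_inv iF'; exists (G' \o F); exact: is_iso_comp.
Qed.
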